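(* For every $\delta \in (0,1)$, there exists a graph $G$ with $m$ edges such that \[ \mathrm{sp}(G) \leq \frac{m}{(\pi-\delta)\,(\chi_{\mathrm{vec}}(G)-1)}. \]
   Context: All graphs are finite and simple. For a graph $G=(V,E)$ with $m$ edges, $\mathrm{mc}(G)$ (the MaxCut of $G$) denotes the maximum number of edges of a bipartite subgraph of $G$, equivalently $\max_{C\subseteq V} e(C, V\setminus C)$, where $e(C,V\setminus C)$ is the number of edges with one endpoint in $C$ and the other in $V\setminus C$. The surplus of $G$ is $\mathrm{sp}(G)=\mathrm{mc}(G)-m/2$. The vector chromatic number $\chi_{\mathrm{vec}}(G)$ is the minimum real number $\kappa\ge 2$ for which there exists an assignment of unit vectors $\mathbf{x}_i$ (in some Euclidean space) to the vertices $i\in V$ such that $\langle \mathbf{x}_i,\mathbf{x}_j\rangle \le -(\kappa-1)^{-1}$ for every edge $ij\in E$. *)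

(* Defs.v *)
From HB Require Import structures.
From mathcomp Require Import all_boot all_order all_algebra.
From mathcomp Require Import all_classical all_reals all_analysis.

Set Implicit Arguments.
Unset Strict Implicit.
Unset Printing Implicit Defensive.

Import Order.TTheory GRing.Theory Num.Theory.

Local Open Scope ring_scope.

Record sgraph := SGraph {
  vertex :> finType;
  adj : rel vertex;
  adj_sym : symmetric adj;
  adj_irrefl : irreflexive adj }.

Definition edges (G : sgraph) : {set {set G}} :=
  [set [set x; y]%SET | x in [set: G]%SET, y in [set: G]%SET & adj x y]%SET.

Definition cut_edges (G : sgraph) (C : {set G}) : {set {set G}} :=
  [set [set x; y]%SET | x in C, y in (~: C)%SET & adj x y]%SET.

Definition maxcut (G : sgraph) : nat :=
  (\max_(C : {set G}) #|cut_edges C|)%N.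

Definition surplus (R : realType) (G : sgraph) : R :=
  (maxcut G)%:R - #|edges G|%:R / 2.

Definition dotp (R : realType) (d : nat) (u v : 'rV[R]_d) : R :=
  \sum_(k < d) u ord0 k * v ord0 k.

Definition vector_colorable (R : realType) (G : sgraph) (kappa : R) : Prop :=
  exists (d : nat) (x : G -> 'rV[R]_d),
    (forall i : G, dotp (x i) (x i) = 1) /\
    (forall i j : G, adj i j -> dotp (x i) (x j) <= - (kappa - 1)^-1).

(* Stated as a relation, so that the minimum is attained by definition. *)
Definition is_vector_chromatic_number (R : realType) (G : sgraph)
    (kappa : R) : Prop :=
  [/\ 2 <= kappa, vector_colorable G kappa &
      forall kappa' : R, 2 <= kappa' -> vector_colorable G kappa' ->
        kappa <= kappa'].

(* Main.v *)
Require Import Defs.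
From HB Require Import structures.
From mathcomp Require Import all_boot all_order all_algebra.
From mathcomp Require Import all_classical all_reals all_analysis.
From mathcomp Require Import perm ring lra.

(**
Take pairs (x, y) of uniform points of a cube whose bits have correlation -r, group the
bits into D blocks of size k, and let the vertices be the vectors z in R^D of block sums.
For F with values in [-1, 1] depending on z only,
   E F(x) F(y) = sum_S (-r)^|S| F^(S)^2 >= - r W_1 - r^3,
where W_1 is the degree-one Fourier weight of F.  As the degree-one coefficients are
constant on blocks, W_1 <= (E|X|)^2 for a normalised Rademacher sum X with small
coefficients, whence W_1 <= 2/pi + o(1) as k grows, by Stein's method.  For fixed k and
large D, <z, z'> is close to - r |z| |z'| with high probability (Chebyshev); discarding
the other pairs gives a weighted graph with a vector colouring of inner products at most
-e, e < r, in which every cut has surplus at most about (r/pi + r^3/2) times the weight.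
A pseudo-random blow-up over a finite field replaces the weights by simple edges, and a
disjoint K_t with e = 1/(t-1) makes the vector chromatic number exactly t.  Since r/e is
as close to 1, and r as close to 0, as desired, the constant pi is approached.
*)

Set Implicit Arguments.
Unset Strict Implicit.
Unset Printing Implicit Defensive.
Import Order.TTheory GRing.Theory Num.Theory.
Import numFieldNormedType.Exports.

Local Open Scope ring_scope.

(** * The solution of Stein's equation for the absolute value *)

Section SteinFunction.
Local Open Scope classical_set_scope.
Variable R : realType.
Implicit Types x y z a u v w t B : R.

Local Notation J := (@gauss_integral_proof.integral0_gauss R).

(** * The Gaussian primitive and Mills' inequalities for its tail *)

Lemma gauss_primitive0 : J 0 = 0.
Proof.
by rewrite /gauss_integral_proof.integral0_gauss set_itv1 Rintegral_set1.
Qed.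

Lemma is_derive_gauss_primitive x : 0 < x -> is_derive x 1 J (gauss_fun x).
Proof.
move=> x0.
suff [d1 d2] : derivable J x 1 /\ J^`() x = gauss_fun x.
  by apply: DeriveDef; [exact: d1 | rewrite -derive1E; exact: d2].
apply: (@continuous_FTC1 R gauss_fun (BLeft 0) x (x + 1) _ _ _ _).
- by rewrite ltrDl.
- apply: continuous_compact_integrable => //; first exact: segment_compact.
  by apply: continuous_subspaceT; exact: continuous_gauss_fun.
- by rewrite /=; rewrite lte_fin.
- exact: continuous_gauss_fun.
Qed.

Lemma within_gauss_primitive x : 0 <= x -> {within `[0, x], continuous J}.
Proof.
move=> x0; rewrite /gauss_integral_proof.integral0_gauss.
apply: parameterized_integral_continuous => //=.
apply: continuous_compact_integrable => //; first exact: segment_compact.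
by apply: continuous_subspaceT; exact: continuous_gauss_fun.
Qed.

Lemma cvg_gauss_primitive : J x @[x --> +oo] --> Num.sqrt pi / 2.
Proof.
have : Num.sqrt (J x ^+ 2) @[x --> +oo] --> Num.sqrt (pi / 4 : R).
  apply: continuous_cvg => //; first exact: sqrt_continuous.
  exact: gauss_integral_proof.cvg_integral0_gauss_sqr.
rewrite sqrtrM ?pi_ge0// sqrtrV// (_ : 4 = 2 ^+ 2); last first.
  by rewrite expr2 -natrM.
rewrite sqrtr_sqr ger0_norm//.
rewrite (_ : (fun _ => Num.sqrt _) = J)//.
apply/funext => r; rewrite sqrtr_sqr// ger0_norm//.
exact: gauss_integral_proof.integral0_gauss_ge0.
Qed.

Lemma is_derive_gauss_fun x : is_derive x 1 (@gauss_fun R) (- 2 * x * gauss_fun x).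
Proof.
rewrite /gauss_fun.
apply: is_derive_eq.
rewrite /GRing.scale /=; ring.
Qed.

Lemma within_itv_sub (f : R -> R) u v : 0 <= u ->
  {within `[0, v], continuous f} -> {within `[u, v], continuous f}.
Proof.
move=> u0; apply: continuous_subspaceW => t /=.
by rewrite !in_itv/= => /andP[? ->]; rewrite andbT (le_trans u0).
Qed.

Lemma withinB (A : set R) (f g : R -> R) :
  {within A, continuous f} -> {within A, continuous g} ->
  {within A, continuous (fun t => f t - g t)}.
Proof. by move=> cf cg t; exact: (continuousB (cf t) (cg t)). Qed.

Lemma withinD (A : set R) (f g : R -> R) :
  {within A, continuous f} -> {within A, continuous g} ->
  {within A, continuous (fun t => f t + g t)}.
Proof. by move=> cf cg t; exact: (continuousD (cf t) (cg t)). Qed.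

Lemma withinM (A : set R) (f g : R -> R) :
  {within A, continuous f} -> {within A, continuous g} ->
  {within A, continuous (fun t => f t * g t)}.
Proof. by move=> cf cg t; exact: (continuousM (cf t) (cg t)). Qed.

Lemma withinN (A : set R) (f : R -> R) :
  {within A, continuous f} -> {within A, continuous (fun t => - f t)}.
Proof. by move=> cf t; exact: (continuousN (cf t)). Qed.

Lemma within_cst (A : set R) (c : R) : {within A, continuous (fun=> c)}.
Proof. by apply: continuous_subspaceT => ?; exact: cvg_cst. Qed.

(** Continuity on the closed interval and derivatives only inside it: this form suits [J], which is
    differentiated at positive points only but is used from [0] on. *)
Lemma le_of_is_derive_ge0 (f df : R -> R) u v : u <= v ->
  {within `[u, v], continuous f} ->
  (forall t, u < t < v -> is_derive t 1 f (df t) /\ 0 <= df t) ->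
  f u <= f v.
Proof.
rewrite le_eqVlt => /predU1P[-> //|uv] cf df0.
have [||c cuv E] := @MVT R f df u v uv.
- by move=> t; rewrite in_itv/= => /df0[].
- exact: cf.
rewrite -subr_ge0 E mulr_ge0 //; last by rewrite subr_ge0 ltW.
by move: cuv; rewrite in_itv/= => /df0[].
Qed.

(** For [t >= y] one has [2 * y * gauss_fun t <= 2 * t * gauss_fun t], and the right side is the
    derivative of [- gauss_fun]. *)
Lemma gauss_primitive_tail y w : 0 <= y <= w ->
  2 * y * (J w - J y) <= gauss_fun y - gauss_fun w.
Proof.
move=> /andP[y0 yw].
have w0 := le_trans y0 yw.
suff : - gauss_fun y - 2 * y * J y <= - gauss_fun w - 2 * y * J w by lra.
apply: (@le_of_is_derive_ge0 (fun t => - gauss_fun t - 2 * y * J t)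
  (fun t => 2 * t * gauss_fun t - 2 * y * gauss_fun t) y w yw).
  apply: withinB; first apply: withinN.
    by apply: continuous_subspaceT; exact: continuous_gauss_fun.
  apply: withinM; first exact: within_cst.
  by apply: within_itv_sub => //; exact: within_gauss_primitive.
move=> t /andP[yt tw]; have t0 : 0 < t by exact: le_lt_trans yt.
have H1 := is_derive_gauss_fun t; have H2 := is_derive_gauss_primitive t0.
split; last by rewrite -mulrBl mulr_ge0 ?gauss_fun_ge0//; lra.
apply: is_derive_eq; rewrite /GRing.scale /=; ring.
Qed.

Lemma gauss_mills_ub y : 0 <= y ->
  2 * y * (Num.sqrt pi / 2 - J y) <= gauss_fun y.
Proof.
move=> y0; rewrite mulrBr lerBlDr.
have C : 2 * y * J w @[w --> +oo] --> 2 * y * (Num.sqrt pi / 2).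
  by apply: cvgM; [exact: cvg_cst | exact: cvg_gauss_primitive].
apply: (cvgr_to_le C); near=> w.
have yw : y <= w by near: w; apply: nbhs_pinfty_ge; rewrite num_real.
have := @gauss_primitive_tail y w; rewrite y0 yw => /(_ isT).
by have := gauss_fun_ge0 w; lra.
Unshelve. all: by end_near. Qed.

(** [ratio t * gauss_fun t] is the classical lower bound for the Gaussian tail beyond [t]: its sum
    with [J] increases to [Num.sqrt pi / 2]. *)
Let ratio t : R := t / (1 + 2 * t ^+ 2).

Let den_gt0 t : 0 < 1 + 2 * t ^+ 2 :> R.
Proof. by have := sqr_ge0 t; lra. Qed.

Lemma is_derive_mills_lb t : 0 < t ->
  is_derive t 1 (fun x => J x + ratio x * gauss_fun x)
    (2 * gauss_fun t / (1 + 2 * t ^+ 2) ^+ 2).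
Proof.
move=> t0; have H1 := is_derive_gauss_fun t; have H2 := is_derive_gauss_primitive t0.
have nz : 1 + 2 * t ^+ 2 != 0 by rewrite gt_eqF.
rewrite /ratio.
have H3 : is_derive t 1 (fun x : R => (1 + 2 * x ^+ 2)^-1)
    (- (1 + 2 * t ^+ 2) ^- 2 *: (4 * t)).
  apply: (@is_deriveV _ (fun x : R => 1 + 2 * x ^+ 2)) => //.
  by apply: is_derive_eq; rewrite /GRing.scale /=; ring.
apply: is_derive_eq; rewrite /GRing.scale /=; field.
by rewrite nz.
Qed.

Lemma continuous_ratio : continuous ratio.
Proof.
move=> t; apply: cvgM; first exact: cvg_id.
apply: cvgV; first by rewrite gt_eqF.
apply: cvgD; first exact: cvg_cst.
apply: cvgM; first exact: cvg_cst.
exact: exprn_continuous.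
Qed.

Lemma gauss_mills_lb y : 0 <= y ->
  y * gauss_fun y <= (1 + 2 * y ^+ 2) * (Num.sqrt pi / 2 - J y).
Proof.
move=> y0; rewrite -ler_pdivrMl// mulrA -[_^-1 * y]mulrC -/(ratio y).
rewrite lerBrDl.
(* Bounding [ratio w] by [1] leaves the limit unchanged. *)
have C : J w + gauss_fun w @[w --> +oo] --> Num.sqrt pi / 2.
  rewrite -[X in _ --> X]addr0.
  by apply: cvgD; [exact: cvg_gauss_primitive | exact: cvg_gauss_fun].
apply: (cvgr_to_ge C); near=> w.
have yw : y <= w by near: w; apply: nbhs_pinfty_ge; rewrite num_real.
have w0 := le_trans y0 yw.
apply: (@le_trans _ _ (J w + ratio w * gauss_fun w)).
  apply: (@le_of_is_derive_ge0 (fun x => J x + ratio x * gauss_fun x)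
    (fun t => 2 * gauss_fun t / (1 + 2 * t ^+ 2) ^+ 2)) => //.
    apply: withinD; first by apply: within_itv_sub => //; exact: within_gauss_primitive.
    apply: withinM; apply: continuous_subspaceT.
      exact: continuous_ratio.
    exact: continuous_gauss_fun.
  move=> t /andP[yt tw]; have t0 : 0 < t by exact: le_lt_trans yt.
  split; first exact: is_derive_mills_lb.
  by rewrite divr_ge0 ?sqr_ge0// mulr_ge0 ?gauss_fun_ge0.
rewrite lerD2l ler_piMl ?gauss_fun_ge0// ler_pdivrMr// mul1r.
by nra.
Unshelve. all: by end_near. Qed.

(** The factor that turns [J] into the error function. It is also twice the mean of [|Y|] for a
    centred Gaussian [Y] of variance 1/2. *)
Definition erf_scale : R := 2 / Num.sqrt pi.
Local Notation s := erf_scale.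

Lemma sqrtpi_gt0 : 0 < Num.sqrt pi :> R.
Proof. by rewrite sqrtr_gt0 pi_gt0. Qed.

Lemma erf_scale_gt0 : 0 < s.
Proof. by rewrite divr_gt0// sqrtpi_gt0. Qed.

(* [1 - erf_scale * J y] is erfc, so this is the scaled function exp(y^2) erfc(y). *)
Definition erfcx y : R := expR (y ^+ 2) * (1 - s * J y).

Local Notation G := erfcx.

(** Minus the derivative of [erfcx] at [y > 0]. *)
Definition stein_slope y : R := s - 2 * y * G y.
Local Notation D := stein_slope.

Lemma erfcxE y : gauss_fun y * G y = s * (Num.sqrt pi / 2 - J y).
Proof.
rewrite /G mulrA -expRD addrC subrr expR0 mul1r mulrBr; congr (_ - _).
by rewrite /s; field; rewrite gt_eqF// sqrtpi_gt0.
Qed.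

Let gauss_gt0 y : 0 < gauss_fun y :> R. Proof. exact: expR_gt0. Qed.

(** After multiplication by [gauss_fun y] this is the upper Mills inequality. *)
Lemma stein_slope_ge0 y : 0 <= y -> 0 <= D y.
Proof.
move=> y0; rewrite subr_ge0 -(ler_pM2l (gauss_gt0 y)) mulrCA erfcxE.
by rewrite mulrCA [gauss_fun y * _]mulrC ler_pM2l ?erf_scale_gt0 ?gauss_mills_ub.
Qed.

Lemma erfcx_mills_lb y : 0 <= y -> y * s <= (1 + 2 * y ^+ 2) * G y.
Proof.
move=> y0; rewrite -(ler_pM2l (gauss_gt0 y)) [leRHS]mulrCA erfcxE.
have := ler_wpM2l (ltW erf_scale_gt0) (gauss_mills_lb y0); lra.
Qed.

Lemma is_derive_erfcx y : 0 < y -> is_derive y 1 G (- D y).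
Proof.
move=> y0; have H := is_derive_gauss_primitive y0.
have H1 : is_derive y 1 (fun x : R => expR (x ^+ 2)) (2 * y * expR (y ^+ 2)).
  by apply: is_derive_eq; rewrite /GRing.scale/=; ring.
rewrite /D /G; apply: is_derive_eq.
have E : expR (y ^+ 2) * gauss_fun y = 1 by rewrite -expRD subrr expR0.
rewrite /GRing.scale /=.
transitivity (- s * (expR (y ^+ 2) * gauss_fun y) +
  (1 - s * J y) * (2 * y * expR (y ^+ 2))); first by ring.
by rewrite E; ring.
Qed.

Lemma within_erfcx y : 0 <= y -> {within `[0, y], continuous G}.
Proof.
move=> y0; apply: withinM.
  apply: continuous_subspaceT => t; apply: continuous_comp.
    exact: exprn_continuous.
  exact: continuous_expR.
apply: withinB; first exact: within_cst.
by apply: withinM; [exact: within_cst | exact: within_gauss_primitive].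
Qed.

Lemma erfcx0 : G 0 = 1.
Proof. by rewrite /G gauss_primitive0 mulr0 subr0 mulr1 expr0n expR0. Qed.

Lemma erfcx_le1 y : 0 <= y -> G y <= 1.
Proof.
move=> y0; rewrite -erfcx0 -lerN2.
apply: (@le_of_is_derive_ge0 (fun t => - G t) D 0 y y0).
  by apply: withinN; exact: within_erfcx.
move=> t /andP[t0 _]; split; last by rewrite stein_slope_ge0 ?ltW.
have H := is_derive_erfcx t0; apply: is_derive_eq; by rewrite opprK.
Qed.

Lemma is_derive_stein_slope y : 0 < y ->
  is_derive y 1 D (2 * (y * s - (1 + 2 * y ^+ 2) * G y)).
Proof.
move=> y0; have H := is_derive_erfcx y0; apply: is_derive_eq.
by rewrite /GRing.scale /= /D; ring.
Qed.

Lemma within_stein_slope y : 0 <= y -> {within `[0, y], continuous D}.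
Proof.
move=> y0; apply: withinB; first exact: within_cst.
apply: withinM; last exact: within_erfcx.
apply: withinM; first exact: within_cst.
by apply: continuous_subspaceT => t; exact: cvg_id.
Qed.

(** The lower Mills inequality says exactly that the derivative of [stein_slope] is nonpositive. *)
Lemma stein_slope_mono u v : 0 <= u <= v -> D v <= D u.
Proof.
move=> /andP[u0 uv]; rewrite -lerN2.
apply: (@le_of_is_derive_ge0 (fun t => - D t)
  (fun y => - (2 * (y * s - (1 + 2 * y ^+ 2) * G y))) u v uv).
  apply: within_itv_sub => //; apply: withinN; apply: within_stein_slope.
  exact: le_trans uv.
move=> t /andP[ut _]; have t0 : 0 < t by exact: le_lt_trans ut.
have H := is_derive_stein_slope t0; split; first exact: is_derive_eq.
by have := erfcx_mills_lb (ltW t0); lra.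
Qed.

(** The derivative satisfies [D' + 2 = 2 * (y * D y + 1 - G y)], which is nonnegative because
    [D y >= 0] and [G y <= 1]. *)
Lemma stein_slope_lip u v : 0 <= u <= v -> D u <= D v + 2 * (v - u).
Proof.
move=> /andP[u0 uv].
suff : D u + 2 * u <= D v + 2 * v by lra.
apply: (@le_of_is_derive_ge0 (fun t => D t + 2 * t)
  (fun y => 2 * (y * s - (1 + 2 * y ^+ 2) * G y) + 2) u v uv).
  apply: within_itv_sub => //; apply: withinD.
    by apply: within_stein_slope; exact: le_trans uv.
  apply: continuous_subspaceT => t; apply: cvgM; first exact: cvg_cst.
  exact: cvg_id.
move=> t /andP[ut _]; have t0 : 0 < t by exact: le_lt_trans ut.
have H := is_derive_stein_slope t0; split.
  by apply: is_derive_eq; rewrite /GRing.scale/=; ring.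
have := erfcx_le1 (ltW t0).
have : 0 <= t * D t by rewrite mulr_ge0 ?stein_slope_ge0 ?ltW.
by rewrite /D; nra.
Qed.

Lemma stein_slope_lip_norm y z : D `|y| <= D `|z| + 2 * `|y - z|.
Proof.
have tri : `| `|y| - `|z| | <= `|y - z| by exact: ler_dist_dist.
have [yz|/ltW zy] := lerP `|y| `|z|.
  have := @stein_slope_lip `|y| `|z|; rewrite normr_ge0 yz => /(_ isT).
  by move: tri; rewrite distrC ger0_norm ?subr_ge0//; lra.
have := @stein_slope_mono `|z| `|y|; rewrite normr_ge0 zy => /(_ isT).
by have := normr_ge0 (y - z); lra.
Qed.

(* Odd, with derivative [stein_slope `|y|]: it solves Stein's equation
   [h' y - 2 y h y = erf_scale - 2 |y|] for a centred Gaussian of variance 1/2. *)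
Definition stein y : R := if 0 <= y then 1 - G y else G (- y) - 1.

Lemma stein_eq y : 2 * `|y| = s + 2 * y * stein y - D `|y|.
Proof.
rewrite /stein /D; case: ifPn => [y0|]; last rewrite -ltNge => y0.
  by rewrite ger0_norm//; ring.
by rewrite ltr0_norm//; ring.
Qed.

Lemma erfcx_increment u v B : 0 <= u <= v ->
  (forall t, u <= t <= v -> D t <= B) -> G u - G v <= B * (v - u).
Proof.
move=> /andP[u0 uv] DB.
suff : G u + B * u <= G v + B * v by lra.
apply: (@le_of_is_derive_ge0 (fun t => G t + B * t) (fun t => - D t + B) u v uv).
  apply: within_itv_sub => //; apply: withinD.
    by apply: within_erfcx; exact: le_trans uv.
  apply: continuous_subspaceT => t; apply: cvgM; first exact: cvg_cst.
  exact: cvg_id.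
move=> t /andP[ut tv]; have t0 : 0 < t by exact: le_lt_trans ut.
have H := is_derive_erfcx t0; split.
  by apply: is_derive_eq; rewrite /GRing.scale/=; ring.
by have := DB t; rewrite (ltW ut) (ltW tv) => /(_ isT); lra.
Qed.

(** A mean value inequality proved on each half-line and glued at [0], where both branches of
    [stein] vanish. *)
Lemma stein_increment u v B : u <= v ->
  (forall t, u <= t <= v -> D `|t| <= B) -> stein v - stein u <= B * (v - u).
Proof.
move=> uv DB.
have [u0|u0] := lerP 0 u.
  have v0 := le_trans u0 uv.
  rewrite /stein u0 v0.
  have := @erfcx_increment u v B; rewrite u0 uv => /(_ isT).
  suff H : forall t, u <= t <= v -> D t <= B by move=> /(_ H); lra.
  move=> t tuv; have := DB t tuv; rewrite ger0_norm//.
  by case/andP: tuv => ut _; exact: le_trans ut.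
have [v0|v0] := lerP 0 v.
  rewrite /stein v0 (lt_geF u0).
  have := @erfcx_increment 0 v B; rewrite lexx v0 => /(_ isT).
  have := @erfcx_increment 0 (- u) B; rewrite lexx oppr_ge0 (ltW u0) => /(_ isT).
  have H1 : forall t, 0 <= t <= - u -> D t <= B.
    move=> t /andP[t0 tu]; have := DB (- t).
    by rewrite normrN ger0_norm//; apply; lra.
  have H2 : forall t, 0 <= t <= v -> D t <= B.
    move=> t /andP[t0 tu]; have := DB t.
    by rewrite ger0_norm//; apply; lra.
  by move=> /(_ H1) + /(_ H2); rewrite erfcx0; lra.
rewrite /stein (lt_geF u0) (lt_geF v0).
have := @erfcx_increment (- v) (- u) B; rewrite oppr_ge0 (ltW v0) lerN2 uv.
move=> /(_ isT).
suff H : forall t, - v <= t <= - u -> D t <= B by move=> /(_ H); lra.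
move=> t /andP[vt tu]; have := DB (- t); rewrite normrN ger0_norm; last lra.
by apply; lra.
Qed.

(* [h (y + a) - h (y - a)] is [2 a h' z] up to second order, for any [z] within [a] of
   [y]: the only smoothness of [stein] that Stein's method uses. *)
Lemma stein_difference y z a : `|z - y| <= `|a| ->
  a * (stein (y + a) - stein (y - a)) <= 2 * a ^+ 2 * (D `|z| + 4 * `|a|).
Proof.
wlog a0 : a / 0 <= a => [hw|].
  have [a0|a0] := lerP 0 a; first exact: hw.
  move=> za; have := hw (- a); rewrite oppr_ge0 (ltW a0) normrN opprK sqrrN.
  by move=> /(_ isT za); lra.
rewrite (ger0_norm a0) => za.
have := @stein_increment (y - a) (y + a) (D `|z| + 4 * a).
have -> : y - a <= y + a by lra.
(* The constant 4 is the Lipschitz constant 2 of the slope times the distance bound [2 * a]. *)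
have H t : y - a <= t <= y + a -> D `|t| <= D `|z| + 4 * a.
  move=> /andP[t1 t2]; apply: (le_trans (stein_slope_lip_norm t z)).
  have : `|t - z| <= 2 * a.
    by move: za; rewrite !ler_norml => /andP[? ?]; apply/andP; split; lra.
  lra.
move=> /(_ isT H) h; have := ler_wpM2l a0 h; lra.
Qed.

End SteinFunction.

(** * Fourier analysis on the cube *)

Section Cube.
Variables (R : realType) (I : finType).
Local Notation cube := {ffun I -> bool}.
Implicit Types (x y : cube) (F : cube -> R) (S : {set I}) (a : I -> R).

Definition sgn (b : bool) : R := if b then 1 else -1.

Lemma sgn_sqr b : sgn b * sgn b = 1.
Proof. by case: b; rewrite /sgn ?mulrNN mulr1. Qed.

Lemma sgn_neg b : sgn (~~ b) = - sgn b.
Proof. by case: b; rewrite /sgn ?opprK. Qed.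

Lemma norm_sgn b : `|sgn b| = 1.
Proof. by case: b; rewrite /sgn ?normrN normr1. Qed.

Definition chi S x : R := \prod_(i in S) sgn (x i).

(** The Fourier coefficient without its normalising factor [2 ^- #|I|]; this is where the powers of
    [2 ^+ #|I|] in later bounds come from. *)
Definition coef F S : R := \sum_x F x * chi S x.

(** Up to the factor [(2 ^+ #|I|) ^- 2], the joint law of two uniform points whose corresponding
    bits have correlation [rho]. *)
Definition noise (rho : R) x y : R :=
  \prod_i (1 + rho * (sgn (x i) * sgn (y i))).

Lemma noise_expand (rho : R) x y :
  noise rho x y =
  \sum_(S : {set I}) rho ^+ #|S| * (chi S x * chi S y).
Proof.
rewrite /noise; under eq_bigr do rewrite addrC.
rewrite bigA_distr; apply: eq_bigr => S _.
rewrite -big_mkcond/= big_split/= prodr_const; congr (_ * _).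
by rewrite big_split.
Qed.

Lemma noise_form (rho : R) F :
  \sum_(x : cube) \sum_(y : cube) noise rho x y * (F x * F y) =
  \sum_(S : {set I}) rho ^+ #|S| * coef F S ^+ 2.
Proof.
under eq_bigr => x _.
  under eq_bigr => y _ do rewrite noise_expand mulr_suml.
  rewrite exchange_big/=.
over.
rewrite exchange_big/=; apply: eq_bigr => S _.
rewrite expr2 /coef mulr_suml mulr_sumr; apply: eq_bigr => x _.
rewrite mulrCA -mulrA mulr_sumr mulr_sumr mulr_sumr; apply: eq_bigr => y _.
by ring.
Qed.

(** The case [rho = 1] of [noise_form]: the kernel then vanishes off the diagonal. *)
Lemma parseval F : \sum_(S : {set I}) coef F S ^+ 2 = 2 ^+ #|I| * \sum_x F x ^+ 2.
Proof.
transitivity (\sum_(S : {set I}) 1 ^+ #|S| * coef F S ^+ 2).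
  by apply: eq_bigr => S _; rewrite expr1n mul1r.
rewrite -noise_form mulr_sumr; apply: eq_bigr => x _.
rewrite (bigD1 x)//= big1 ?addr0 => [|y yx].
  rewrite -expr2; congr (_ * _); rewrite /noise.
  under eq_bigr do rewrite sgn_sqr mulr1.
  by rewrite prodr_const; congr (_ ^+ _).
have [i xyi] : exists i, x i != y i.
  apply/existsP; apply: contraR yx; rewrite negb_exists => /forallP h.
  by apply/eqP/ffunP => i; have := h i; rewrite negbK => /eqP.
rewrite /noise (bigD1 i)//=.
suff -> : 1 + 1 * (sgn (x i) * sgn (y i)) = 0 by rewrite !mul0r.
by move: xyi; case: (x i); case: (y i) => // _; rewrite /sgn; ring.
Qed.

Definition deg1 F i : R := \sum_x F x * sgn (x i).

Lemma coef_set1 F i : coef F [set i] = deg1 F i.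
Proof. by apply: eq_bigr => x _; rewrite /chi big_set1. Qed.

Lemma sum_deg1 F : \sum_(S : {set I} | #|S| == 1%N) coef F S ^+ 2 =
  \sum_i deg1 F i ^+ 2.
Proof.
transitivity (\sum_(S in [set [set i]%SET | i : I]%SET) coef F S ^+ 2).
  apply: eq_bigl => S; apply/cards1P/imsetP => [[i ->]|[i _ ->]]; by exists i.
rewrite big_imset/=; last by move=> i j _ _; exact: set1_inj.
by apply: eq_big => // i _; rewrite coef_set1.
Qed.

(** In [noise_form] the terms of even degree are nonnegative, those of degree one are kept, and
    those of odd degree at least three cost at most [r ^+ 3] times the total weight, which Parseval
    bounds. *)
Lemma noise_form_ge (r : R) F : 0 <= r <= 1 -> (forall x, `|F x| <= 1) ->
  - r * \sum_i deg1 F i ^+ 2 - r ^+ 3 * (2 ^+ #|I|) ^+ 2 <=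
  \sum_(x : cube) \sum_(y : cube) noise (- r) x y * (F x * F y).
Proof.
move=> /andP[r0 r1] F1.
rewrite noise_form -sum_deg1.
have P : \sum_(S : {set I}) coef F S ^+ 2 <= (2 ^+ #|I|) ^+ 2.
  rewrite parseval [leRHS]expr2 ler_wpM2l ?exprn_ge0//.
  apply: (@le_trans _ _ (\sum_(x : cube) 1)).
    by apply: ler_sum => x _; rewrite -real_normK ?num_real// expr_le1.
  by rewrite sumr_const card_ffun card_bool natrX.
apply: (@le_trans _ _ (- r * (\sum_(S : {set I} | #|S| == 1%N) coef F S ^+ 2)
    - r ^+ 3 * \sum_(S : {set I}) coef F S ^+ 2)).
  by rewrite lerD2l lerN2 ler_wpM2l ?exprn_ge0.
rewrite big_mkcond/= !mulr_sumr -sumrN -big_split/=; apply: ler_sum => S _.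
rewrite -mulNr -(fun_if (fun z => z)).
have c0 := sqr_ge0 (coef F S); have r30 : 0 <= r ^+ 3 by exact: exprn_ge0.
have rn n : (3 <= n)%N -> r ^+ n <= r ^+ 3 by move=> n3; rewrite ler_wiXn2l.
have rn0 n : 0 <= r ^+ n by exact: exprn_ge0.
case: (#|S|) => [|[|n]] /=; rewrite ?expr0 ?expr1.
- by nra.
- by nra.
- rewrite mulr0 add0r ler_wpM2r// exprNn -signr_odd.
  case: (boolP (odd n.+2)) => on; rewrite ?expr1 ?expr0 ?mul1r ?mulN1r.
    by rewrite lerN2 rn//; case: n on.
  by apply: (le_trans _ (rn0 _)); rewrite oppr_le0.
Qed.

(** * Stein's method for Rademacher sums, by flipping coordinates *)

Definition flip i x : cube := [ffun j => if j == i then ~~ x j else x j].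

Lemma flipK i : involutive (flip i).
Proof.
by move=> x; apply/ffunP => j; rewrite !ffunE; case: eqP => // _; rewrite negbK.
Qed.

Lemma sum_flip i F : \sum_x F x = \sum_x F (flip i x).
Proof. exact: (reindex_inj (inv_inj (flipK i))). Qed.

Definition lin a x : R := \sum_i a i * sgn (x i).

Lemma lin_flip a i x : lin a (flip i x) = lin a x - 2 * (a i * sgn (x i)).
Proof.
rewrite /lin (bigD1 i)//= [in RHS](bigD1 i)//= ffunE eqxx sgn_neg.
rewrite (eq_bigr (fun j => a j * sgn (x j))) => [|j /negPf ji]; first by ring.
by rewrite ffunE ji.
Qed.

(* Stein's method: flipping the sign of one coordinate turns [E (X h X)] into a sum of
   symmetric differences of [h], close to [E (h' X) / 2], so that [E |X|] is close to
   the Gaussian value. *)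
Lemma sum_norm_lin a (tau : R) : \sum_i a i ^+ 2 = 2^-1 ->
  (forall i, `|a i| <= tau) ->
  \sum_(x : cube) `|lin a x| <= 2 ^+ #|I| * ((Num.sqrt pi)^-1 + 2 * tau).
Proof.
move=> a1 atau.
have step i : \sum_(x : cube) 2 * (a i * sgn (x i)) * stein (lin a x) <=
    \sum_(x : cube) 2 * a i ^+ 2 * (stein_slope `|lin a x| + 4 * tau).
  have -> : \sum_(x : cube) 2 * (a i * sgn (x i)) * stein (lin a x) =
      \sum_(x : cube) a i * sgn (x i) * (stein (lin a x) - stein (lin a (flip i x))).
    transitivity (\sum_(x : cube) a i * sgn (x i) * stein (lin a x) +
        \sum_(x : cube) a i * sgn (x i) * stein (lin a x)).
      by rewrite -big_split/=; apply: eq_bigr => x _; ring.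
    rewrite [X in _ + X](sum_flip i) -big_split/=; apply: eq_bigr => x _.
    by rewrite ffunE eqxx sgn_neg; ring.
  apply: ler_sum => x _; rewrite lin_flip.
  set al := a i * sgn (x i).
  have al2 : al ^+ 2 = a i ^+ 2 by rewrite exprMn [sgn _ ^+ 2]expr2 sgn_sqr mulr1.
  have aln : `|al| = `|a i| by rewrite normrM norm_sgn mulr1.
  (* The centre [lin a x - al] is the sum without coordinate [i]; adding and subtracting [al] gives
     its values at [x] and at [flip i x]. *)
  have := @stein_difference R (lin a x - al) (lin a x) al.
  rewrite opprB addrCA subrr addr0 lexx => /(_ isT).
  have -> : lin a x - al - al = lin a x - 2 * al by ring.
  rewrite subrK al2 aln => h.
  apply: (le_trans h); apply: ler_wpM2l; first by rewrite mulr_ge0 ?sqr_ge0.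
  by rewrite lerD2l ler_wpM2l.
have N : \sum_(x : cube) 1 = 2 ^+ #|I| :> R.
  by rewrite sumr_const card_ffun card_bool natrX.
have tot : \sum_(x : cube) 2 * lin a x * stein (lin a x) <=
    \sum_(x : cube) (stein_slope `|lin a x| + 4 * tau).
  apply: (@le_trans _ _ (\sum_i \sum_(x : cube) 2 * (a i * sgn (x i)) * stein (lin a x))).
    rewrite exchange_big/= le_eqVlt; apply/orP; left; apply/eqP.
    apply: eq_bigr => x _; rewrite -mulr_suml; congr (_ * _).
    by rewrite /lin mulr_sumr.
  apply: (@le_trans _ _ (\sum_i \sum_(x : cube)
      2 * a i ^+ 2 * (stein_slope `|lin a x| + 4 * tau))).
    by apply: ler_sum => i _; exact: step.
  rewrite exchange_big/= le_eqVlt; apply/orP; left; apply/eqP.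
  by apply: eq_bigr => x _; rewrite -mulr_suml -mulr_sumr a1 mulfV ?pnatr_eq0// mul1r.
(* Substituting Stein's equation, the slope terms cancel against those of [tot]. *)
have : \sum_(x : cube) 2 * `|lin a x| <= \sum_(x : cube) (erf_scale R + 4 * tau).
  under eq_bigr do rewrite stein_eq addrAC.
  rewrite big_split/= -lerBrDl; apply: (le_trans tot).
  rewrite -sumrB le_eqVlt; apply/orP; left; apply/eqP.
  by apply: eq_bigr => x _; ring.
rewrite -mulr_sumr -[X in \sum_(x : cube) X]mul1r -mulr_suml N /erf_scale.
set S := \sum_(x : cube) _ => h; have p0 := @sqrtpi_gt0 R.
have -> : (Num.sqrt pi)^-1 + 2 * tau = (2 / Num.sqrt pi + 4 * tau) / 2 :> R.
  by field; rewrite gt_eqF.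
by rewrite mulrA ler_pdivlMr// mulrC.
Qed.

(** Duality: for [a i = deg1 F i / Num.sqrt (2 * W)], of square sum 1/2, the pairing of [F] with
    [lin a] is [W / Num.sqrt (2 * W)], and it is at most the sum of [|lin a x|] since [|F| <= 1].
    The last hypothesis says that [|a i| <= tau]. *)
Lemma deg1_le F (tau : R) : 0 <= tau -> (forall x, `|F x| <= 1) ->
  (forall i, deg1 F i ^+ 2 <= 2 * tau ^+ 2 * \sum_j deg1 F j ^+ 2) ->
  \sum_i deg1 F i ^+ 2 <=
    2 * (2 ^+ #|I| * ((Num.sqrt pi)^-1 + 2 * tau)) ^+ 2.
Proof.
move=> tau0 F1; set W := \sum_i _ => H.
have W0 : 0 <= W by apply: sumr_ge0 => i _; exact: sqr_ge0.
set B := _ * (_ + _).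
have [->|Wn0] := eqVneq W 0; first by rewrite mulr_ge0 ?sqr_ge0.
have Wp : 0 < W by rewrite lt0r Wn0.
pose n := Num.sqrt (2 * W).
have n0 : 0 < n by rewrite sqrtr_gt0 mulr_gt0.
have n2 : n ^+ 2 = 2 * W by rewrite sqr_sqrtr// mulr_ge0.
have nn0 : n != 0 by rewrite gt_eqF.
pose a i := deg1 F i / n.
have a1 : \sum_i a i ^+ 2 = 2^-1.
  under eq_bigr do rewrite exprMn exprVn n2.
  by rewrite -mulr_suml -/W; field.
have atau i : `|a i| <= tau.
  rewrite -(@ler_pXn2r _ 2)// ?nnegrE// real_normK ?num_real//.
  by rewrite exprMn exprVn n2 ler_pdivrMr ?mulr_gt0// mulrCA mulrA H.
have := sum_norm_lin a1 atau; rewrite -/B => h.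
have h2 : W / n <= B.
  apply: le_trans h.
  have -> : W / n = \sum_(x : cube) F x * lin a x.
    rewrite /W mulr_suml /lin.
    under [RHS]eq_bigr do rewrite mulr_sumr.
    rewrite exchange_big/=; apply: eq_bigr => i _.
    rewrite expr2 -mulrA {1}/deg1 mulr_suml; apply: eq_bigr => x _.
    by rewrite /a; ring.
  apply: ler_sum => x _; apply: (le_trans (ler_norm _)).
  by rewrite normrM ler_piMl.
have -> : W = 2 * (W / n) ^+ 2 by rewrite exprMn exprVn n2; field.
rewrite ler_wpM2l// ler_pXn2r// nnegrE ?divr_ge0 ?ltW//.
by apply: lt_le_trans h2; rewrite divr_gt0.
Qed.

End Cube.

(** * Pseudo-random blow-up of a weighted graph *)

Lemma sum_prod_type (W : nmodType) (A B : finType) (f : A * B -> W) :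
  \sum_x f x = \sum_a \sum_b f (a, b).
Proof. by rewrite pair_bigA; apply: eq_bigr => -[]. Qed.

Lemma sum_const (W : pzRingType) (T : finType) (c : W) :
  \sum_(x : T) c = #|T|%:R * c.
Proof. by rewrite sumr_const mulr_natl. Qed.

Section PseudoRandom.
Variables (R : realType) (F : finFieldType).
Implicit Types (i j : F * F) (f g : F * F -> R) (b : F -> R).
Local Notation q := (#|F|%:R : R).

(** For fixed [i] and [c], the points [j] with [incid i j = c] form a line of slope [- i.1] in the
    affine plane, and the relation is symmetric. *)
Definition incid i j : F := i.1 * j.1 + i.2 + j.2.

Lemma incidC i j : incid i j = incid j i.
Proof. by rewrite /incid mulrC addrAC. Qed.

(** Lines of different slopes meet in one point, so [(incid i j, incid i' j)] takes each pair of
    values exactly once. *)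
Lemma incid_uncorrelated b i i' : \sum_c b c = 0 -> i.1 != i'.1 ->
  \sum_j b (incid i j) * b (incid i' j) = 0.
Proof.
case: i i' => [i1 i2] [i1' i2'] /= b0 ii'.
rewrite sum_prod_type.
pose tr (j1 c : F) := c - (i1 * j1 + i2).
have trI (j1 : F) : injective (tr j1) by move=> c d /addIr.
under eq_bigr => j1 _ do rewrite (reindex_inj (trI j1))/=.
rewrite exchange_big/= big1// => c _.
transitivity (b c * \sum_j1 b (c + (i1' - i1) * j1 + (i2' - i2))).
  rewrite mulr_sumr; apply: eq_bigr => j1 _; rewrite /incid /tr /=.
  congr (b _ * b _); ring.
have affI : injective (fun j1 : F => c + (i1' - i1) * j1 + (i2' - i2)).
  move=> x y /addIr /addrI /mulfI; apply.
  by rewrite subr_eq0 eq_sym.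
by rewrite -(reindex_inj affI (P := xpredT) (F := b)) b0 mulr0.
Qed.

(* Only pairs with equal first coordinates contribute: there are [q ^ 3] of them. *)
Lemma incid_energy b f : \sum_c b c = 0 -> (forall c, `|b c| <= 1) ->
  (forall i, `|f i| <= 1) ->
  \sum_j (\sum_i b (incid i j) * f i) ^+ 2 <= q ^+ 5.
Proof.
move=> b0 b1 f1.
have -> : \sum_j (\sum_i b (incid i j) * f i) ^+ 2 =
    \sum_i \sum_i' f i * f i' * \sum_j b (incid i j) * b (incid i' j).
  transitivity (\sum_j \sum_i \sum_i'
      f i * f i' * (b (incid i j) * b (incid i' j))).
    apply: eq_bigr => j _; rewrite expr2 mulr_suml; apply: eq_bigr => i _.
    by rewrite mulr_sumr; apply: eq_bigr => i' _; ring.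
  rewrite exchange_big/=; apply: eq_bigr => i _.
  rewrite exchange_big/=; apply: eq_bigr => i' _.
  by rewrite mulr_sumr.
have prod_le1 (s t : R) : `|s| <= 1 -> `|t| <= 1 -> `|s * t| <= 1.
  by move=> s1 t1; rewrite normrM mulr_ile1.
have cardFF : #|{: F * F}|%:R = q ^+ 2 by rewrite card_prod natrM expr2.
have le_term i i' : f i * f i' * \sum_j b (incid i j) * b (incid i' j) <=
    (i.1 == i'.1)%:R * q ^+ 2.
  have [e|ne] := eqVneq i.1 i'.1; last first.
    by rewrite incid_uncorrelated// mulr0 mul0r.
  rewrite mul1r; apply: (le_trans (ler_norm _)).
  rewrite normrM -[leRHS]mul1r ler_pM ?normr_ge0 ?prod_le1//.
  apply: (le_trans (ler_norm_sum _ _ _)).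
  rewrite -cardFF -sumr_const; apply: ler_sum => j _; exact: prod_le1.
apply: (@le_trans _ _ (\sum_(i : F * F) \sum_(i' : F * F) (i.1 == i'.1)%:R * q ^+ 2)).
  by apply: ler_sum => i _; apply: ler_sum => i' _.
have fiber (i : F * F) : \sum_(i' : F * F) (i.1 == i'.1)%:R = q.
  rewrite sum_prod_type exchange_big/=.
  under eq_bigr => d _.
    rewrite (bigD1 i.1)//= eqxx big1 ?addr0; last first.
      by move=> c; rewrite eq_sym => /negPf ->.
  over.
  by rewrite sum_const mulr1.
under eq_bigr => i _ do rewrite -mulr_suml fiber.
rewrite sum_const cardFF.
by rewrite le_eqVlt; apply/orP; left; apply/eqP; ring.
Qed.

(** The energy bound gains a factor of the order of the square root of [q] over the trivial bound
    [q ^+ 4], and [1 <= th ^+ 2 * q] expresses this gain as [th]. *)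
Lemma incid_discrepancy b f g (th : R) :
  \sum_c b c = 0 -> (forall c, `|b c| <= 1) ->
  (forall i, `|f i| <= 1) -> (forall j, `|g j| <= 1) ->
  0 < th -> 1 <= th ^+ 2 * q ->
  `|\sum_i \sum_j b (incid i j) * (f i * g j)| <= th * q ^+ 4.
Proof.
move=> b0 b1 f1 g1 th0 thq.
have q0 : 0 < q by rewrite ltr0n; apply/card_gt0P; exists 0.
have cardFF : #|{: F * F}|%:R = q ^+ 2 by rewrite card_prod natrM expr2.
pose H j := \sum_i b (incid i j) * f i.
have -> : \sum_i \sum_j b (incid i j) * (f i * g j) = \sum_j g j * H j.
  rewrite exchange_big/=; apply: eq_bigr => j _.
  by rewrite mulr_sumr; apply: eq_bigr => i _; ring.
apply: (le_trans (ler_norm_sum _ _ _)).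
pose lam : R := th * q ^+ 2.
have lam0 : 0 < lam by rewrite mulr_gt0 ?exprn_gt0.
(* AM-GM with the weight [lam] balancing [q ^ 4] against the energy [q ^ 5] *)
apply: (@le_trans _ _ (\sum_(j : F * F) (lam + H j ^+ 2 / lam) / 2)).
  apply: ler_sum => j _.
  have -> : `|g j * H j| = `|g j| * `|H j| by rewrite normrM.
  apply: (@le_trans _ _ `|H j|); first by rewrite ler_piMl.
  rewrite ler_pdivlMr// -(ler_pM2r lam0) mulrDl divfK ?gt_eqF//.
  rewrite -(real_normK (num_real (H j))).
  by have := sqr_ge0 (lam - `|H j|); nra.
rewrite -mulr_suml big_split/= sum_const cardFF -mulr_suml ler_pdivrMr//.
have E := incid_energy b0 b1 f1; rewrite -/H in E.
have : (\sum_j H j ^+ 2) / lam <= q ^+ 5 / lam by rewrite ler_pM2r ?invr_gt0.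
have : q ^+ 5 / lam <= th * q ^+ 4.
  rewrite ler_pdivrMr// /lam.
  have -> : th * q ^+ 4 * (th * q ^+ 2) = th ^+ 2 * q * q ^+ 5 by ring.
  by rewrite ler_peMl// exprn_ge0// ltW.
rewrite /H /lam.
have -> : q ^+ 2 * (th * q ^+ 2) = th * q ^+ 4 by ring.
lra.
Qed.

End PseudoRandom.

(** * Replacing edge weights by densities of simple edges *)

Section BlowUp.
Variables (R : realType) (V : finType) (p : V -> V -> R).
Hypothesis p01 : forall u v, 0 <= p u v <= 1.
Hypothesis psym : forall u v, p u v = p v u.
Hypothesis pdiag : forall u, p u u = 0.

Variable F : finFieldType.
Local Notation q := (#|F|%:R : R).

(** The number of values of [incid] that are declared edges: [p u v] rounded down to a multiple of
    [1 / q]. *)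
Definition level u v : nat := Num.truncn (q * p u v).

Let qp0 u v : 0 <= q * p u v.
Proof. by rewrite mulr_ge0//; case/andP: (p01 u v). Qed.

Lemma level_le u v : (level u v)%:R <= q * p u v.
Proof. by have /andP[] := truncn_itv (qp0 u v). Qed.

Lemma level_gt u v : q * p u v < (level u v)%:R + 1.
Proof. by have /andP[_] := truncn_itv (qp0 u v); rewrite -natr1. Qed.

Lemma level_card u v : (level u v <= #|F|)%N.
Proof.
rewrite -(ler_nat R); apply: (le_trans (level_le u v)).
by rewrite ler_piMr//; case/andP: (p01 u v).
Qed.

(* Between the fibres of [u] and [v] this is a pseudo-random bipartite graph of density
   about [p u v]. *)
Definition blowup_adj : rel (V * (F * F)) := fun x y =>
  (enum_rank (incid x.2 y.2) < level x.1 y.1)%N.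

Lemma blowup_adj_sym : symmetric blowup_adj.
Proof. by move=> x y; rewrite /blowup_adj incidC /level psym. Qed.

Lemma blowup_adj_irrefl : irreflexive blowup_adj.
Proof. by move=> x; rewrite /blowup_adj /level pdiag mulr0 truncn0 ltn0. Qed.

Lemma blowup_adj_gt0 x y : blowup_adj x y -> 0 < p x.1 y.1.
Proof.
rewrite lt0r; case/andP: (p01 x.1 y.1) => -> _; rewrite andbT.
by apply: contraTneq => p0; rewrite /blowup_adj /level p0 mulr0 truncn0 ltn0.
Qed.

(** Up to a small error the blow-up sees a function only through these averages, so a cut becomes a
    fractional cut of [V], with values in [[-1, 1]]. *)
Definition fiber_mean (f : V * (F * F) -> R) u : R := (\sum_i f (u, i)) / q ^+ 2.

Let q0 : 0 < q. Proof. by rewrite ltr0n; apply/card_gt0P; exists 0. Qed.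

Let cardFF : #|{: F * F}|%:R = q ^+ 2.
Proof. by rewrite card_prod natrM expr2. Qed.

Lemma norm_fiber_mean f u : (forall x, `|f x| <= 1) -> `|fiber_mean f u| <= 1.
Proof.
move=> f1; rewrite normrM normfV [`|q ^+ 2|]ger0_norm ?exprn_ge0//.
rewrite ler_pdivrMr ?exprn_gt0// mul1r.
apply: (le_trans (ler_norm_sum _ _ _)).
by rewrite -cardFF -sumr_const; apply: ler_sum.
Qed.

Lemma fiber_mean1 u : fiber_mean (fun=> 1) u = 1.
Proof.
by rewrite /fiber_mean sum_const mulr1 cardFF mulfV// expf_neq0// gt_eqF.
Qed.

Lemma sum_level N : (N <= #|F|)%N ->
  \sum_(c : F) (enum_rank c < N)%N%:R = N%:R :> R.
Proof.
move=> NF.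
transitivity (\sum_(k < #|F|) (k < N)%N%:R : R).
  rewrite [RHS](reindex (@enum_rank F))//.
  by exists enum_val => c _; rewrite ?enum_rankK ?enum_valK.
transitivity (\sum_(k < #|F| | (k < N)%N) (1 : R)).
  by rewrite [RHS]big_mkcond; apply: eq_bigr => k _; case: ifP.
by rewrite -(big_ord_widen _ (fun=> 1))// sumr_const card_ord.
Qed.

(** Each pair [u], [v] contributes two errors of relative size [th]: the discrepancy of the centred
    indicator of the chosen field values, and the rounding of [p u v]. *)
Lemma blowup_form f (th : R) : (forall x, `|f x| <= 1) ->
  0 < th <= 1 -> 1 <= th ^+ 2 * q ->
  `|\sum_x \sum_y (blowup_adj x y)%:R * (f x * f y) -
    q ^+ 4 * \sum_u \sum_v p u v * (fiber_mean f u * fiber_mean f v)| <=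
  q ^+ 4 * (2 * th * #|V|%:R ^+ 2).
Proof.
move=> f1 /andP[th0 th1] thq; set g := fiber_mean f.
have -> : \sum_x \sum_y (blowup_adj x y)%:R * (f x * f y) =
    \sum_u \sum_v \sum_i \sum_j
     (enum_rank (incid i j) < level u v)%N%:R * (f (u, i) * f (v, j)).
  rewrite sum_prod_type.
  apply: eq_bigr => u _; rewrite [RHS]exchange_big/=; apply: eq_bigr => i _.
  by rewrite sum_prod_type.
rewrite mulr_sumr -sumrB.
under eq_bigr do rewrite mulr_sumr -sumrB.
have term u v : `|\sum_i \sum_j
     (enum_rank (incid i j) < level u v)%N%:R * (f (u, i) * f (v, j)) -
     q ^+ 4 * (p u v * (g u * g v))| <= q ^+ 4 * (2 * th).
  set N := level u v.
  pose b (c : F) : R := (enum_rank c < N)%N%:R - N%:R / q.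
  have Nq : N%:R / q <= 1 by rewrite ler_pdivrMr// mul1r ler_nat level_card.
  have Nq0 : 0 <= N%:R / q by rewrite divr_ge0.
  have b0 : \sum_c b c = 0.
    rewrite sumrB sum_level ?level_card// sum_const.
    by rewrite mulrCA mulfV ?mulr1 ?subrr// gt_eqF.
  have b1 c : `|b c| <= 1.
    by rewrite /b ler_norml; case: (_ < _)%N => /=; apply/andP; split; lra.
  have := incid_discrepancy b0 b1 (fun i => f1 (u, i)) (fun j => f1 (v, j)) th0 thq.
  set A := \sum_i \sum_j _.
  set B := \sum_i \sum_j _.
  have -> : A = B - q ^+ 4 * (N%:R / q * (g u * g v)).
    rewrite /A /B /b /g /fiber_mean.
    have -> : q ^+ 4 * (N%:R / q * ((\sum_i f (u, i)) / q ^+ 2 *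
        ((\sum_i f (v, i)) / q ^+ 2))) =
        N%:R / q * ((\sum_i f (u, i)) * \sum_j f (v, j)).
      by field; rewrite gt_eqF.
    rewrite mulr_suml mulr_sumr -sumrB; apply: eq_bigr => i _.
    rewrite mulr_sumr mulr_sumr -sumrB; apply: eq_bigr => j _.
    by ring.
  (* Since [th <= 1], this puts the rounding error [1 / q] below [th]. *)
  have qth : 1 <= q * th.
    apply: (le_trans thq); rewrite expr2 -mulrA [q * th]mulrC ler_piMl//.
    by rewrite mulr_ge0// ltW.
  have pN : `|N%:R / q - p u v| <= th.
    have lo : p u v - q^-1 <= N%:R / q.
      rewrite ler_pdivlMr// mulrBl mulVf ?gt_eqF// lerBlDr mulrC.
      exact/ltW/level_gt.
    have hi : N%:R / q <= p u v by rewrite ler_pdivrMr// mulrC level_le.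
    have qi : q^-1 <= th by rewrite -[leLHS]mul1r ler_pdivrMr// mulrC.
    by rewrite ler_norml; apply/andP; split; lra.
  have gg : `|g u * g v| <= 1 by rewrite normrM mulr_ile1 ?norm_fiber_mean.
  have q40 : 0 < q ^+ 4 by exact: exprn_gt0.
  have second : `|q ^+ 4 * ((N%:R / q - p u v) * (g u * g v))| <= q ^+ 4 * th.
    rewrite normrM (ger0_norm (ltW q40)) ler_pM2l// normrM.
    by rewrite -[th]mulr1 ler_pM.
  move=> first.
  have -> : B - q ^+ 4 * (p u v * (g u * g v)) =
    (B - q ^+ 4 * (N%:R / q * (g u * g v))) +
    q ^+ 4 * ((N%:R / q - p u v) * (g u * g v)) by ring.
  by apply: (le_trans (ler_normD _ _)); lra.
apply: (le_trans (ler_norm_sum _ _ _)).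
apply: (@le_trans _ _ (\sum_(u : V) \sum_(v : V) q ^+ 4 * (2 * th))).
  apply: ler_sum => u _; apply: (le_trans (ler_norm_sum _ _ _)).
  by apply: ler_sum => v _; exact: term.
rewrite !sum_const.
by rewrite le_eqVlt; apply/orP; left; apply/eqP; ring.
Qed.

End BlowUp.

(** [Z] counts the pairs of points between two fibres. Making it exceed any given [Z0] lets a fixed
    number of additional edges be absorbed later. *)
Lemma blowup (R : realType) (V : finType) (p : V -> V -> R) (e Z0 : R) :
  (forall u v, 0 <= p u v <= 1) -> (forall u v, p u v = p v u) ->
  (forall u, p u u = 0) -> 0 < e ->
  exists (G : sgraph) (pr : G -> V) (Z : R),
  [/\ 0 < Z, Z0 <= Z, forall x y : G, adj x y -> 0 < p (pr x) (pr y),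
   `|\sum_(x : G) \sum_(y : G) (adj x y)%:R - Z * \sum_u \sum_v p u v| <= Z * e
   & forall f : G -> R, (forall x, `|f x| <= 1) ->
     exists2 g : V -> R, (forall u, `|g u| <= 1) &
     `|\sum_(x : G) \sum_(y : G) (adj x y)%:R * (f x * f y) -
       Z * \sum_u \sum_v p u v * (g u * g v)| <= Z * e].
Proof.
move=> p01 psym pdiag e0.
pose c : R := 2 * #|V|%:R ^+ 2 + 1.
have c0 : 0 < c by rewrite /c ltr_wpDl// mulr_ge0 ?exprn_ge0.
pose th := Num.min 1 (e / c).
have th0 : 0 < th by rewrite lt_min ltr01 divr_gt0.
have th1 : th <= 1 by rewrite ge_min lexx.
have the : 2 * th * #|V|%:R ^+ 2 <= e.
  have : th * c <= e by rewrite -ler_pdivlMr// ge_min lexx orbT.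
  by rewrite /c; lra.
(* Any prime [r] above [m] satisfies both [th ^- 2 <= r] and [Z0 <= r <= r ^ 4]. *)
pose m := maxn (Num.bound (th ^- 2)) (Num.bound Z0).
have [r mr pr_r] := prime_above m.
have [F cF] : exists F : finFieldType, #|F| = r.
  by exists 'F_r; exact: card_Fp.
have ltr (z : R) : (Num.bound z <= m)%N -> z <= r%:R.
  move=> zm; have [z0|z0] := lerP z 0; first by apply: (le_trans z0).
  apply/ltW/(lt_le_trans (archi_boundP (ltW z0))).
  by rewrite ler_nat (leq_trans zm)// ltnW.
have r1 : 1 <= r%:R :> R by rewrite ler1n prime_gt0.
have r4 : 0 < r%:R ^+ 4 :> R by rewrite exprn_gt0// (lt_le_trans ltr01).
have thr : 1 <= th ^+ 2 * #|F|%:R.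
  rewrite cF mulrC -ler_pdivrMr ?exprn_gt0// mul1r.
  by apply: ltr; exact: leq_maxl.
have rZ : Z0 <= r%:R ^+ 4.
  apply: (@le_trans _ _ r%:R); first by apply: ltr; exact: leq_maxr.
  by rewrite -[leLHS]expr1 ler_weXn2l.
have th01 : 0 < th <= 1 by rewrite th0 th1.
exists (SGraph (blowup_adj_sym psym (F := F)) (blowup_adj_irrefl pdiag (F := F))).
exists fst, (r%:R ^+ 4); split => //.
- by move=> x y; exact: (blowup_adj_gt0 p01).
- have n1 (x : V * (F * F)) : `|1| <= 1 :> R by rewrite normr1.
  have := blowup_form p01 n1 th01 thr; rewrite cF => h.
  apply: (@le_trans _ _ (r%:R ^+ 4 * (2 * th * #|V|%:R ^+ 2))); last first.
    by rewrite ler_wpM2l// ltW.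
  apply: le_trans h; rewrite le_eqVlt; apply/orP; left; apply/eqP.
  congr (`|_ - _ * _|).
  + by apply: eq_bigr => x _; apply: eq_bigr => y _; rewrite !mulr1.
  + by apply: eq_bigr => u _; apply: eq_bigr => v _; rewrite !fiber_mean1 !mulr1.
- move=> f f1; exists (fiber_mean f); first by move=> u; exact: norm_fiber_mean.
  have := blowup_form p01 f1 th01 thr; rewrite cF => h.
  by apply: (le_trans h); rewrite ler_wpM2l// ltW.
Qed.

(** * The weighted graph of block sums *)

Section ProductMeasure.
Variables (R : realType) (J T : finType) (w : T -> R).
Hypothesis w1 : \sum_t w t = 1.
Implicit Types (g h : T -> R) (om : {ffun J -> T}).

Definition prodw om : R := \prod_j w (om j).

Lemma sum_prodw : \sum_om prodw om = 1.
Proof. by rewrite /prodw -(bigA_distr_bigA (fun=> w)) big1. Qed.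

Lemma sum_prodw_fun (G : J -> T -> R) :
  \sum_om prodw om * \prod_j G j (om j) = \prod_j \sum_t w t * G j t.
Proof.
by rewrite bigA_distr_bigA/=; apply: eq_bigr => om _; rewrite -big_split.
Qed.

Lemma sum_prodw1 j g : \sum_om prodw om * g (om j) = \sum_t w t * g t.
Proof.
pose G i t := if i == j then g t else 1.
transitivity (\sum_om prodw om * \prod_i G i (om i)).
  apply: eq_bigr => om _; congr (_ * _).
  rewrite (bigD1 j)//= /G eqxx big1 ?mulr1// => i /negPf ->//.
rewrite sum_prodw_fun (bigD1 j)//= [X in _ * X]big1 ?mulr1.
  by rewrite /G eqxx.
move=> i /negPf ij; rewrite /G ij -[RHS]w1.
by apply: eq_bigr => t _; rewrite mulr1.
Qed.

Lemma sum_prodw2 i j g h : i != j ->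
  \sum_om prodw om * (g (om i) * h (om j)) =
  (\sum_t w t * g t) * \sum_t w t * h t.
Proof.
move=> ij.
pose G l t := if l == i then g t else if l == j then h t else 1.
transitivity (\sum_om prodw om * \prod_l G l (om l)).
  apply: eq_bigr => om _; congr (_ * _).
  rewrite (bigD1 i)//= (bigD1 j) 1?eq_sym//= /G eqxx eq_sym (negPf ij) eqxx.
  by rewrite big1 ?mulr1// => l /andP[/negPf -> /negPf ->].
rewrite sum_prodw_fun (bigD1 i)//= (bigD1 j) 1?eq_sym//=.
rewrite [X in _ * (_ * X)]big1 ?mulr1.
  by rewrite /G eqxx eq_sym (negPf ij) eqxx.
move=> l /andP[/negPf li /negPf lj]; rewrite /G li lj -[RHS]w1.
by apply: eq_bigr => t _; rewrite mulr1.
Qed.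

(** Off-diagonal terms factor by independence and vanish because [g] has mean zero. This serves both
    for the moments inside a block and for the variance over blocks. *)
Lemma covariance_sum g h : \sum_t w t * g t = 0 ->
  \sum_om prodw om * ((\sum_i g (om i)) * \sum_j h (om j)) =
  #|J|%:R * \sum_t w t * (g t * h t).
Proof.
move=> g0.
transitivity (\sum_i \sum_j \sum_om prodw om * (g (om i) * h (om j))).
  transitivity (\sum_om \sum_i \sum_j prodw om * (g (om i) * h (om j))).
    apply: eq_bigr => om _; rewrite mulr_suml mulr_sumr; apply: eq_bigr => i _.
    by rewrite mulr_sumr mulr_sumr.
  rewrite exchange_big/=; apply: eq_bigr => i _.
  by rewrite exchange_big.
transitivity (\sum_(i : J) \sum_t w t * (g t * h t)); last by rewrite sum_const.
apply: eq_bigr => i _; rewrite (bigD1 i)//= [X in _ + X]big1 ?addr0.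
  exact: (sum_prodw1 i (fun t => g t * h t)).
by move=> j ji; rewrite sum_prodw2 1?eq_sym// g0 mul0r.
Qed.

End ProductMeasure.

(** * Pairs of correlated points, grouped into independent blocks *)

Section NoiseBlocks.
Variables (R : realType) (D k : nat) (r e : R).
Hypotheses (r01 : 0 < r <= 1) (e0r : 0 < e < r) (k0 : (0 < k)%N) (D0 : (0 < D)%N).
Local Notation I := ('I_D * 'I_k)%type.
Local Notation cube := {ffun I -> bool}.
Local Notation sg := (@sgn R).

(** The joint law of two uniform bits of correlation [- r]. *)
Definition bitw (t : bool * bool) : R := (1 - r * (sg t.1 * sg t.2)) / 4.

Lemma sum_bool2 (f : bool * bool -> R) : \sum_t f t =
  f (true, true) + f (true, false) + (f (false, true) + f (false, false)).
Proof. by rewrite sum_prod_type !big_bool. Qed.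

Lemma sum_bitw : \sum_t bitw t = 1.
Proof. by rewrite sum_bool2 /bitw /sgn /=; field. Qed.

Lemma sum_bitw_fst : \sum_t bitw t * sg t.1 = 0.
Proof. by rewrite sum_bool2 /bitw /sgn /=; field. Qed.

Lemma sum_bitw_snd : \sum_t bitw t * sg t.2 = 0.
Proof. by rewrite sum_bool2 /bitw /sgn /=; field. Qed.

Lemma bitw_ge0 t : 0 <= bitw t.
Proof.
rewrite divr_ge0//; case/andP: r01 => r0 r1.
by case: t => -[] []; rewrite /sgn /=; lra.
Qed.

Definition pairw (x y : cube) : R := \prod_i bitw (x i, y i).

Lemma pairw_ge0 x y : 0 <= pairw x y.
Proof. by apply: prodr_ge0 => i _; exact: bitw_ge0. Qed.

Lemma pairwC x y : pairw x y = pairw y x.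
Proof. by apply: eq_bigr => i _; rewrite /bitw/= [sg _ * _]mulrC. Qed.

Lemma pairwE x y : pairw x y = noise (- r) x y / (2 ^+ #|{: I}|) ^+ 2.
Proof.
rewrite /pairw /bitw /noise big_split/= prodr_const; congr (_ * _).
  by apply: eq_bigr => i _; rewrite mulNr.
by rewrite exprVn -exprM mulnC exprM; congr (_ ^+ _)^-1; rewrite -natrX.
Qed.

Local Notation block := {ffun 'I_k -> bool * bool}.
(** Two points of the cube are the same data as [D] blocks of [k] pairs of bits; read this way, the
    blocks are independent under [prodw]. *)
Definition unblock1 (om : {ffun 'I_D -> block}) : cube := [ffun p => (om p.1 p.2).1].
Definition unblock2 (om : {ffun 'I_D -> block}) : cube := [ffun p => (om p.1 p.2).2].

Lemma sum_unblock (f : cube -> cube -> R) :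
  \sum_x \sum_y f x y = \sum_om f (unblock1 om) (unblock2 om).
Proof.
rewrite -(sum_prod_type (fun xy => f xy.1 xy.2)).
rewrite (reindex (fun om => (unblock1 om, unblock2 om)))//=.
exists (fun xy : cube * cube =>
  [ffun b : 'I_D => [ffun i : 'I_k => (xy.1 (b, i), xy.2 (b, i))]]).
  move=> om _; apply/ffunP => b; apply/ffunP => i.
  by rewrite !ffunE /= -surjective_pairing.
move=> [x y] _; congr pair; apply/ffunP => -[b i]; by rewrite !ffunE.
Qed.

Local Notation blockw := (prodw (J := 'I_k) bitw).

Lemma pairw_unblock om : pairw (unblock1 om) (unblock2 om) = prodw blockw om.
Proof.
rewrite /pairw /prodw pair_bigA; apply: eq_bigr => -[b i] _.
by rewrite !ffunE /= -surjective_pairing.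
Qed.

Lemma sum_pairw : \sum_x \sum_y pairw x y = 1.
Proof.
rewrite sum_unblock; under eq_bigr do rewrite pairw_unblock.
by rewrite sum_prodw// sum_prodw// sum_bitw.
Qed.

Definition block_sum (x : cube) b : R := \sum_(i < k) sg (x (b, i)).

(** Summed over blocks, this bounds [<z, z'> + e |z| |z'|] from above by AM-GM; unlike that
    expression it is a sum of independent terms. *)
Definition qform (z z' : R) : R := z * z' + e / 2 * (z ^+ 2 + z' ^+ 2).

Definition blockq (tau : block) : R :=
  qform (\sum_i sg (tau i).1) (\sum_i sg (tau i).2).

Let m : R := k%:R * (r - e).

(** The two sums over a block have covariance [- r * k] and second moments [k], so [blockq] has mean
    [- k * (r - e)]. *)
Lemma mean_blockq : \sum_tau blockw tau * (blockq tau + m) = 0.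
Proof.
have E1 := covariance_sum 'I_k sum_bitw (fun t => sg t.2) sum_bitw_fst.
have E2 := covariance_sum 'I_k sum_bitw (fun t => sg t.1) sum_bitw_fst.
have E3 := covariance_sum 'I_k sum_bitw (fun t => sg t.2) sum_bitw_snd.
rewrite card_ord in E1 E2 E3.
transitivity (k%:R * (\sum_t bitw t * (sg t.1 * sg t.2)) +
  e / 2 * (k%:R * (\sum_t bitw t * (sg t.1 * sg t.1)) +
           k%:R * (\sum_t bitw t * (sg t.2 * sg t.2))) + m).
  have M : \sum_tau blockw tau * m = m.
    by rewrite -mulr_suml (sum_prodw 'I_k sum_bitw) mul1r.
  rewrite -E1 -E2 -E3 -[X in _ = _ + X]M.
  rewrite -big_split/= mulr_sumr -!big_split/=; apply: eq_bigr => tau _.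
  by rewrite /blockq /qform; ring.
by rewrite !sum_bool2 /bitw /sgn /= /m; field.
Qed.

Lemma norm_sum_sgn (f : 'I_k -> bool) : `|\sum_i sg (f i)| <= k%:R.
Proof.
apply: (le_trans (ler_norm_sum _ _ _)).
by under eq_bigr do rewrite norm_sgn; rewrite sum_const card_ord mulr1.
Qed.

(* A crude bound is enough, since [D] is chosen after [k]. *)
Lemma blockq_bound tau : (blockq tau + m) ^+ 2 <= 9 * k%:R ^+ 4.
Proof.
have k1 : 1 <= k%:R :> R by rewrite ler1n.
have := norm_sum_sgn (fun i => (tau i).1).
have := norm_sum_sgn (fun i => (tau i).2).
rewrite /blockq /qform; set z := \sum_i sg (tau i).1; set z' := \sum_i sg (tau i).2.
set K := k%:R in k1 *; move=> hz' hz.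
case/andP: r01 => r0 r1; case/andP: e0r => e0 er.
have z2 : z ^+ 2 <= K ^+ 2.
  by rewrite -(real_normK (num_real z)) ler_pXn2r ?nnegrE//; lra.
have z'2 : z' ^+ 2 <= K ^+ 2.
  by rewrite -(real_normK (num_real z')) ler_pXn2r ?nnegrE//; lra.
have zz' : `|z * z'| <= K ^+ 2 by rewrite normrM expr2 ler_pM.
have S0 : 0 <= z ^+ 2 + z' ^+ 2 by rewrite addr_ge0 ?sqr_ge0.
have es : 0 <= e / 2 * (z ^+ 2 + z' ^+ 2) <= K ^+ 2.
  by apply/andP; split; nra.
have mm : 0 <= m <= K ^+ 2.
  by rewrite /m -/K; apply/andP; split; nra.
have -> : 9 * K ^+ 4 = (3 * K ^+ 2) ^+ 2 by ring.
rewrite -(real_normK (num_real (_ + m))) ler_pXn2r ?nnegrE//; last by nra.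
move: zz' es mm; rewrite !ler_norml => /andP[? ?] /andP[? ?] /andP[? ?].
by apply/andP; split; lra.
Qed.

(** * Concentration of the quadratic form *)

Definition totq (x y : cube) : R := \sum_b qform (block_sum x b) (block_sum y b).

Lemma totq_unblock om : totq (unblock1 om) (unblock2 om) = \sum_b blockq (om b).
Proof.
apply: eq_bigr => b _; rewrite /blockq /block_sum.
by congr qform; apply: eq_bigr => i _; rewrite !ffunE.
Qed.

(** Chebyshev's inequality: [totq] has mean [- D * m] and variance at most [9 * D * k ^ 4], with
    [m = k * (r - e)]. *)
Lemma chebyshev_totq :
  \sum_x \sum_y pairw x y * (0 <= totq x y)%R%:R <=
  9 * k%:R ^+ 2 / (D%:R * (r - e) ^+ 2).
Proof.
case/andP: e0r => e0 er.
have re0 : 0 < r - e by rewrite subr_gt0.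
have kr0 : 0 < k%:R :> R by rewrite ltr0n.
have Dr0 : 0 < D%:R :> R by rewrite ltr0n.
have m0 : 0 < m by rewrite mulr_gt0.
pose mu : R := D%:R * m.
have mu0 : 0 < mu by rewrite mulr_gt0.
apply: (@le_trans _ _ (\sum_x \sum_y pairw x y * ((totq x y + mu) ^+ 2 / mu ^+ 2))).
  apply: ler_sum => x _; apply: ler_sum => y _; rewrite ler_wpM2l ?pairw_ge0//.
  have [q0|_] := lerP 0 (totq x y); last by rewrite divr_ge0 ?sqr_ge0.
  rewrite ler_pdivlMr ?exprn_gt0// mul1r.
  have mu0' := ltW mu0; by rewrite ler_pXn2r ?nnegrE ?addr_ge0// lerDr.
rewrite sum_unblock.
have -> : \sum_om pairw (unblock1 om) (unblock2 om) *
    ((totq (unblock1 om) (unblock2 om) + mu) ^+ 2 / mu ^+ 2) =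
    (\sum_(om : {ffun 'I_D -> block}) prodw blockw om *
      ((\sum_b (blockq (om b) + m)) * \sum_b (blockq (om b) + m))) / mu ^+ 2.
  rewrite mulr_suml; apply: eq_bigr => om _.
  have -> : \sum_b (blockq (om b) + m) = \sum_b blockq (om b) + mu.
    by rewrite big_split/= sum_const card_ord.
  by rewrite pairw_unblock totq_unblock mulrA expr2.
have w1 : \sum_tau blockw tau = 1 by rewrite sum_prodw// sum_bitw.
have /= C := covariance_sum 'I_D w1 (fun tau => blockq tau + m) mean_blockq.
rewrite C card_ord.
rewrite ler_pdivrMr ?exprn_gt0//.
apply: (@le_trans _ _ (D%:R * (9 * k%:R ^+ 4))).
  rewrite ler_wpM2l// -[leRHS]mul1r -[X in _ <= X * _]w1 mulr_suml.
  apply: ler_sum => tau _; apply: ler_wpM2l.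
    by apply: prodr_ge0 => i _; exact: bitw_ge0.
  exact: blockq_bound.
rewrite le_eqVlt; apply/orP; left; apply/eqP; rewrite /mu /m.
by field; rewrite !gt_eqF.
Qed.

(** * The weighted graph on vectors of block counts *)

Local Notation V := {ffun 'I_D -> 'I_k.+1}.

(* Vertices only see the block sums of [x]: this makes the degree-one coefficients of a
   cut constant on blocks and rules out the dictator cuts of the cube. *)
Definition counts (x : cube) : V := [ffun b => inord (\sum_(i < k) x (b, i))%N].

Definition centred (u : V) b : R := 2 * (u b)%:R - k%:R.

Lemma centred_counts x b : centred (counts x) b = block_sum x b.
Proof.
rewrite /centred ffunE inordK; last first.
  rewrite ltnS -[leqRHS]card_ord -sum1_card; apply: leq_sum => i _; exact: leq_b1.
have kE : k%:R = \sum_(i < k) 1 :> R by rewrite sum_const card_ord mulr1.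
rewrite natr_sum mulr_sumr /block_sum kE -sumrB.
by apply: eq_bigr => i _; rewrite /sgn; case: (x (b, i)) => /=; ring.
Qed.

Definition vertq (u v : V) : R := \sum_b qform (centred u b) (centred v b).

Lemma vertq_counts x y : vertq (counts x) (counts y) = totq x y.
Proof. by apply: eq_bigr => b _; rewrite !centred_counts. Qed.

(* By AM-GM, [vertq u v < 0] forces [<z, z'> <= - e |z| |z'|] for the centred vectors
   [z, z'] of [u, v], and [z, z' <> 0]. *)
Definition weight (u v : V) : R := (vertq u v < 0)%R%:R *
  \sum_(x | counts x == u) \sum_(y | counts y == v) pairw x y.

Lemma sum_weight (f : V -> V -> R) : \sum_u \sum_v weight u v * f u v =
  \sum_x \sum_y pairw x y * ((totq x y < 0)%R%:R * f (counts x) (counts y)).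
Proof.
rewrite [RHS](partition_big counts xpredT)//=; apply: eq_bigr => u _.
under [RHS]eq_bigr => x _ do rewrite (partition_big counts xpredT)//=.
rewrite [RHS]exchange_big/=; apply: eq_bigr => v _.
rewrite /weight -mulrA mulrCA mulr_suml; apply: eq_bigr => x /eqP xu.
rewrite mulr_suml; apply: eq_bigr => y /eqP yv.
by rewrite -vertq_counts xu yv.
Qed.

Lemma weight_ge0 u v : 0 <= weight u v.
Proof.
by rewrite mulr_ge0//; do 2 (apply: sumr_ge0 => ? _); exact: pairw_ge0.
Qed.

Lemma weight_le1 u v : weight u v <= 1.
Proof.
rewrite -sum_pairw.
apply: (@le_trans _ _ (\sum_(x | counts x == u) \sum_(y | counts y == v) pairw x y)).
  rewrite ler_piMl//; last by case: (_ < _); rewrite ?ler01.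
  by do 2 (apply: sumr_ge0 => ? _); exact: pairw_ge0.
apply: (@le_trans _ _ (\sum_(x | counts x == u) \sum_y pairw x y)).
  apply: ler_sum => x _; rewrite [leRHS](bigID (fun y => counts y == v))/=.
  by rewrite lerDl sumr_ge0// => y _; exact: pairw_ge0.
rewrite [leRHS](bigID (fun x => counts x == u))/= lerDl.
by do 2 (apply: sumr_ge0 => ? _); exact: pairw_ge0.
Qed.

Lemma weightC u v : weight u v = weight v u.
Proof.
rewrite /weight exchange_big/=; congr (_%:R * _).
  congr (_ < _); apply: eq_bigr => b _; rewrite /qform; ring.
by apply: eq_bigr => x _; apply: eq_bigr => y _; exact: pairwC.
Qed.

(** [qform z z] is [(1 + e) * z ^+ 2], hence [vertq u u] is never negative. *)
Lemma weight_diag u : weight u u = 0.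
Proof.
rewrite /weight ltNge sumr_ge0 ?mul0r// => b _; rewrite /qform.
case/andP: e0r => e0 _; have := sqr_ge0 (centred u b); nra.
Qed.

Lemma sum_weight_ge :
  1 - 9 * k%:R ^+ 2 / (D%:R * (r - e) ^+ 2) <= \sum_u \sum_v weight u v.
Proof.
have -> : \sum_u \sum_v weight u v = \sum_u \sum_v weight u v * 1.
  by apply: eq_bigr => u _; apply: eq_bigr => v _; rewrite mulr1.
rewrite (sum_weight (fun _ _ => 1)) lerBlDr.
apply: (@le_trans _ _ (\sum_x \sum_y pairw x y * ((totq x y < 0)%R%:R * 1) +
    \sum_x \sum_y pairw x y * (0 <= totq x y)%R%:R)); last first.
  by rewrite lerD2l chebyshev_totq.
rewrite -big_split/= -[leLHS]sum_pairw; apply: ler_sum => x _.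
rewrite -big_split/=; apply: ler_sum => y _.
by rewrite (leNgt 0 (totq x y)); case: (totq x y < 0)%R => /=; lra.
Qed.

(** Transposing two coordinates of one block permutes the cube and preserves [counts]. *)
Lemma deg1_counts (g : V -> R) b i i' :
  deg1 (g \o counts) (b, i) = deg1 (g \o counts) (b, i').
Proof.
pose sw (x : cube) : cube :=
  [ffun p : I => if p.1 == b then x (p.1, tperm i i' p.2) else x p].
have swK : involutive sw.
  move=> x; apply/ffunP => -[c j]; rewrite !ffunE /=.
  by case: eqP => // ->; rewrite tpermK.
rewrite /deg1 (reindex_inj (inv_inj swK))/=; apply: eq_bigr => x _.
rewrite [sw x (b, i)]ffunE /= eqxx tpermL; congr (g _ * _).
apply/ffunP => c; rewrite !ffunE; congr inord.
case: (eqVneq c b) => [->|/negPf cb]; last first.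
  by apply: eq_bigr => j _; rewrite ffunE /= cb.
rewrite [RHS](reindex_inj (@perm_inj _ (tperm i i')))/=.
by apply: eq_bigr => j _; rewrite ffunE /= eqxx.
Qed.

(** The form over all pairs is bounded through [noise_form_ge] and [deg1_le], and the discarded
    pairs cost at most their probability. The [k] coefficients of a block being equal, each square
    is at most [1 / k] of their total, which [1 <= 2 * tau ^+ 2 * k%:R] converts into the smallness
    required by [deg1_le]. *)
Lemma weight_form (g : V -> R) (tau : R) : 0 <= tau ->
  1 <= 2 * tau ^+ 2 * k%:R -> (forall u, `|g u| <= 1) ->
  - (r * (2 * ((Num.sqrt pi)^-1 + 2 * tau) ^+ 2) + r ^+ 3 +
     9 * k%:R ^+ 2 / (D%:R * (r - e) ^+ 2)) <=
  \sum_u \sum_v weight u v * (g u * g v).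
Proof.
move=> tau0 tauk g1; case/andP: (r01) => r0 r1.
pose F := g \o counts.
have F1 x : `|F x| <= 1 by exact: g1.
pose N : R := 2 ^+ #|{: I}|.
have N0 : 0 < N by rewrite exprn_gt0.
have r01' : 0 <= r <= 1 by rewrite (ltW r0).
have NF := noise_form_ge r01' F1.
have DF : \sum_p deg1 F p ^+ 2 <= 2 * (N * ((Num.sqrt pi)^-1 + 2 * tau)) ^+ 2.
  apply: deg1_le => // -[b i].
  have S0 : 0 <= \sum_j deg1 F j ^+ 2 by apply: sumr_ge0 => ? _; exact: sqr_ge0.
  apply: (@le_trans _ _ (2 * tau ^+ 2 * k%:R * deg1 F (b, i) ^+ 2)).
    by rewrite ler_peMl ?sqr_ge0.
  rewrite -mulrA ler_wpM2l ?mulr_ge0 ?sqr_ge0//.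
  rewrite sum_prod_type (bigD1 b)//= -[leLHS]addr0 lerD//.
    rewrite -{1}[k]card_ord -sum_const le_eqVlt; apply/orP; left; apply/eqP.
    by apply: eq_bigr => i' _; rewrite (deg1_counts g b i i').
  by do 2 (apply: sumr_ge0 => ? _); exact: sqr_ge0.
have full : - (r * (2 * ((Num.sqrt pi)^-1 + 2 * tau) ^+ 2) + r ^+ 3) <=
    \sum_x \sum_y pairw x y * (F x * F y).
  have -> : \sum_x \sum_y pairw x y * (F x * F y) =
      (\sum_x \sum_y noise (- r) x y * (F x * F y)) / N ^+ 2.
    rewrite mulr_suml; apply: eq_bigr => x _; rewrite mulr_suml.
    by apply: eq_bigr => y _; rewrite pairwE mulrAC.
  rewrite ler_pdivlMr ?exprn_gt0//; apply: le_trans NF; rewrite -/N.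
  have := ler_wpM2l (ltW r0) DF; rewrite exprMn.
  lra.
rewrite sum_weight.
have -> : \sum_x \sum_y pairw x y *
    ((totq x y < 0)%R%:R * (g (counts x) * g (counts y))) =
    \sum_x \sum_y pairw x y * (F x * F y) -
    \sum_x \sum_y pairw x y * ((0 <= totq x y)%R%:R * (F x * F y)).
  rewrite -sumrB; apply: eq_bigr => x _; rewrite -sumrB; apply: eq_bigr => y _.
  by rewrite (leNgt 0 (totq x y)) /F /=; case: (totq x y < 0)%R => /=; ring.
have bad : \sum_x \sum_y pairw x y * ((0 <= totq x y)%R%:R * (F x * F y)) <=
    9 * k%:R ^+ 2 / (D%:R * (r - e) ^+ 2).
  apply: le_trans chebyshev_totq; apply: ler_sum => x _; apply: ler_sum => y _.
  rewrite ler_wpM2l ?pairw_ge0// ler_piMr//.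
  apply: (le_trans (ler_norm _)); rewrite normrM mulr_ile1//; exact: F1.
lra.
Qed.

(** * Unit vectors attached to the vertices *)

Definition sqnorm (u : V) : R := \sum_b centred u b ^+ 2.

(** The basis vector is a default for vertices at the origin, which have no edge of positive
    weight. *)
Definition unit_vec (u : V) : 'rV[R]_D :=
  if sqnorm u == 0 then \row_b (b == Ordinal D0)%:R
  else \row_b (centred u b / Num.sqrt (sqnorm u)).

Lemma sqnorm_ge0 u : 0 <= sqnorm u.
Proof. by apply: sumr_ge0 => b _; exact: sqr_ge0. Qed.

Lemma dotp_unit_vec u : dotp (unit_vec u) (unit_vec u) = 1.
Proof.
rewrite /dotp /unit_vec; case: ifPn => [_|n0].
  rewrite (bigD1 (Ordinal D0))//= big1 ?addr0; first by rewrite !mxE eqxx mulr1.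
  by move=> b /negPf b0; rewrite !mxE b0 mul0r.
have sq0 : Num.sqrt (sqnorm u) != 0.
  by rewrite sqrtr_eq0 -ltNge lt0r n0 sqnorm_ge0.
have sn : Num.sqrt (sqnorm u) ^+ 2 = sqnorm u by rewrite sqr_sqrtr ?sqnorm_ge0.
transitivity (sqnorm u / Num.sqrt (sqnorm u) ^+ 2); last by rewrite sn mulfV.
rewrite [X in X / _]/sqnorm mulr_suml; apply: eq_bigr => b _.
by rewrite !mxE; field.
Qed.

Lemma dotp_weight u v : 0 < weight u v -> dotp (unit_vec u) (unit_vec v) <= - e.
Proof.
case/andP: (e0r) => e0 _.
have [q0 _|/negbTE q0] := boolP (vertq u v < 0); last first.
  by rewrite /weight q0 mul0r ltxx.
have qE : vertq u v = \sum_b centred u b * centred v b +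
    e / 2 * (sqnorm u + sqnorm v).
  by rewrite /sqnorm -big_split/= mulr_sumr -big_split.
have zero w : sqnorm w = 0 -> forall b, centred w b = 0.
  move=> /eqP; rewrite psumr_eq0 => [/allP h b|b _]; last exact: sqr_ge0.
  by have := h b; rewrite mem_index_enum sqrf_eq0 => /(_ isT) /eqP.
have su : sqnorm u != 0.
  apply: contraTneq q0 => s0; rewrite qE s0 add0r -leNgt addr_ge0//.
    by rewrite sumr_ge0// => b _; rewrite zero// mul0r.
  by rewrite mulr_ge0 ?sqnorm_ge0// divr_ge0// ltW.
have sv : sqnorm v != 0.
  apply: contraTneq q0 => s0; rewrite qE s0 addr0 -leNgt addr_ge0//.
    by rewrite sumr_ge0// => b _; rewrite (zero v)// mulr0.
  by rewrite mulr_ge0 ?sqnorm_ge0// divr_ge0// ltW.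
rewrite /unit_vec (negPf su) (negPf sv).
set n1 := Num.sqrt (sqnorm u); set n2 := Num.sqrt (sqnorm v).
have n10 : 0 < n1 by rewrite sqrtr_gt0 lt0r su sqnorm_ge0.
have n20 : 0 < n2 by rewrite sqrtr_gt0 lt0r sv sqnorm_ge0.
have -> : dotp (\row_b (centred u b / n1)) (\row_b (centred v b / n2)) =
    (\sum_b centred u b * centred v b) / (n1 * n2).
  rewrite /dotp mulr_suml; apply: eq_bigr => b _; rewrite !mxE invfM; ring.
rewrite ler_pdivrMr ?mulr_gt0//.
have s1 : n1 ^+ 2 = sqnorm u by rewrite sqr_sqrtr ?sqnorm_ge0.
have s2 : n2 ^+ 2 = sqnorm v by rewrite sqr_sqrtr ?sqnorm_ge0.
move: q0; rewrite qE -s1 -s2; have := sqr_ge0 (n1 - n2).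
nra.
Qed.

End NoiseBlocks.

(** * Surplus and vector chromatic number *)

Lemma exists_nat_ge (R : realType) (a : R) : exists2 n : nat, (0 < n)%N & a <= n%:R.
Proof.
exists (Num.truncn `|a|).+1 => //.
apply: (le_trans (ler_norm _)); apply: ltW.
by case/andP: (truncn_itv (normr_ge0 a)).
Qed.

(** The order of choices is [tau] from [eta], then [k] from [tau], then [D] from [k], since the
    Chebyshev bound grows with [k] and decays with [D]. *)
Lemma weighted_graph (R : realType) (r e eta : R) :
  0 < e < r -> r <= 1 -> 0 < eta ->
  exists (V : finType) (p : V -> V -> R) (D : nat) (vec : V -> 'rV[R]_D),
  [/\ (forall u v, 0 <= p u v <= 1) /\ (forall u v, p u v = p v u),
    forall u, p u u = 0,
    (forall u, dotp (vec u) (vec u) = 1) /\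
    (forall u v, 0 < p u v -> dotp (vec u) (vec v) <= - e),
    1 - eta <= \sum_u \sum_v p u v &
    forall g : V -> R, (forall u, `|g u| <= 1) ->
      - (r * (2 / pi) + r ^+ 3 + 2 * eta) <= \sum_u \sum_v p u v * (g u * g v)].
Proof.
move=> er r1 eta0; case/andP: (er) => e0 e_r.
have r0 : 0 < r by exact: lt_trans e_r.
have r01 : 0 < r <= 1 by rewrite r0.
pose tau := Num.min 1 (eta / 16).
have tau0 : 0 < tau by rewrite lt_min ltr01 divr_gt0.
have tau1 : tau <= 1 by rewrite ge_min lexx.
have taue : 16 * tau <= eta.
  by rewrite mulrC -ler_pdivlMr// ge_min lexx orbT.
have [k k0 kt] := exists_nat_ge (tau ^- 2).
have tauk : 1 <= 2 * tau ^+ 2 * k%:R.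
  have : 1 <= tau ^+ 2 * k%:R.
    by rewrite mulrC -ler_pdivrMr ?exprn_gt0// mul1r.
  lra.
have re0 : 0 < r - e by rewrite subr_gt0.
have [D D0 Dk] := exists_nat_ge (9 * k%:R ^+ 2 / (eta * (r - e) ^+ 2)).
have cheb : 9 * k%:R ^+ 2 / (D%:R * (r - e) ^+ 2) <= eta.
  have c0 : 0 < (r - e) ^+ 2 by rewrite exprn_gt0.
  rewrite ler_pdivrMr ?mulr_gt0 ?ltr0n//.
  by move: Dk; rewrite ler_pdivrMr ?mulr_gt0//; lra.
exists {ffun 'I_D -> 'I_k.+1}, (weight r e), D, (unit_vec R D0); split.
- split=> u v; last exact: weightC.
  by rewrite weight_ge0// weight_le1.
- by move=> u; apply: weight_diag.
- by split=> [u|u v]; [exact: dotp_unit_vec | exact: dotp_weight].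
- apply: le_trans (sum_weight_ge r01 er k0 D0); lra.
- move=> g g1; apply: le_trans (weight_form r01 er k0 D0 (ltW tau0) tauk g1).
  have p0 := pi_gt0 R.
  have sp0 : 0 < Num.sqrt pi :> R by rewrite sqrtr_gt0.
  have sp1 : 1 <= Num.sqrt pi :> R.
    by rewrite -[leLHS]sqrtr1 ler_wsqrtr//; have := pi_ge2 R; lra.
  have E : (Num.sqrt pi)^-1 ^+ 2 = pi^-1 :> R by rewrite exprVn sqr_sqrtr// ltW.
  have I1 : (Num.sqrt pi)^-1 <= 1 :> R by rewrite invf_le1.
  have I0 : 0 < (Num.sqrt pi)^-1 :> R by rewrite invr_gt0.
  (* The cross term and the square each contribute at most [8 * tau]. *)
  have h : 2 * ((Num.sqrt pi)^-1 + 2 * tau) ^+ 2 <= 2 / pi + 16 * tau.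
    rewrite sqrrD E; set s := (Num.sqrt pi)^-1 in I1 I0 *.
    have : s * tau <= tau by rewrite ler_piMl// ltW.
    have : tau ^+ 2 <= tau by rewrite expr2 ler_piMl// ltW.
    rewrite exprMn -mulr_natr; lra.
  have : r * (2 * ((Num.sqrt pi)^-1 + 2 * tau) ^+ 2) <= r * (2 / pi) + eta.
    apply: (@le_trans _ _ (r * (2 / pi) + r * (16 * tau))).
      by rewrite -mulrDr ler_wpM2l// ltW.
    by rewrite lerD2l; apply: (le_trans _ taue); rewrite ler_piMl// mulr_ge0// ltW.
  lra.
Qed.

Section Surplus.
Variables (R : realType) (G : sgraph).

Definition arcs : R := \sum_(x : G) \sum_(y : G) (adj x y)%:R.

(** An edge [{a, b}] can only come from the ordered pairs [(a, b)] and [(b, a)]. *)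
Lemma arcs_le_edges : arcs <= 2 * #|edges G|%:R.
Proof.
pose P (xy : G * G) := adj xy.1 xy.2.
have -> : arcs = #|[set xy | P xy]|%:R.
  rewrite /arcs -(sum_prod_type (fun xy : G * G => (P xy)%:R)) -sum1_card natr_sum.
  by rewrite [RHS]big_mkcond; apply: eq_bigr => xy _; rewrite inE; case: (P xy).
rewrite -natrM ler_nat -sum1_card.
pose h (xy : G * G) : {set G} := [set xy.1; xy.2]%SET.
rewrite (partition_big h (fun E => E \in edges G))/=; last first.
  move=> [x y]; rewrite inE /P /= => xy.
  by apply/imset2P; exists x y; rewrite ?inE.
rewrite mulnC -sum_nat_const; apply: leq_sum => E.
case/imset2P => a b _ _ ->; rewrite sum1dep_card.
apply: (@leq_trans #|[set (a, b); (b, a)]%SET|); last by rewrite cards2 ltnS leq_b1.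
apply/subset_leq_card/fintype.subsetP => -[x y]; rewrite !inE /h /= => /andP[xy /eqP Exy].
have xE : x \in [set a; b]%SET by rewrite -Exy !inE eqxx.
have yE : y \in [set a; b]%SET by rewrite -Exy !inE eqxx orbT.
have aE : a \in [set x; y]%SET by rewrite Exy !inE eqxx.
have bE : b \in [set x; y]%SET by rewrite Exy !inE eqxx orbT.
have ne : x != y by apply: contraTneq xy => ->; rewrite /P /= adj_irrefl.
move: xE yE ne; rewrite !inE => /orP[] /eqP -> /orP[] /eqP ->; rewrite ?eqxx ?orbT//.
Qed.

Lemma cut_le_form (C : {set G}) (f : G -> R) :
  f = (fun x => if x \in C then 1 else -1) ->
  #|cut_edges C|%:R <=
  (arcs - \sum_(x : G) \sum_(y : G) (adj x y)%:R * (f x * f y)) / 4.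
Proof.
move=> fE.
pose Q (xy : G * G) := [&& xy.1 \in C, xy.2 \notin C & adj xy.1 xy.2].
have le1 : (#|cut_edges C| <= #|[set xy | Q xy]|)%N.
  apply: leq_trans (leq_imset_card (fun xy : G * G => [set xy.1; xy.2]%SET) _).
  apply/subset_leq_card/fintype.subsetP => E /imset2P[x y xC].
  rewrite !inE => /andP[yC xy] ->.
  by apply/imsetP; exists (x, y) => //; rewrite inE /Q /= xC yC xy.
have -> : (arcs - \sum_(x : G) \sum_(y : G) (adj x y)%:R * (f x * f y)) / 4 =
    #|[set xy | Q xy]|%:R.
  have -> : #|[set xy | Q xy]|%:R = \sum_(x : G) \sum_(y : G) (Q (x, y))%:R :> R.
    rewrite -(sum_prod_type (fun xy : G * G => (Q xy)%:R)) -sum1_card natr_sum.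
    by rewrite [LHS]big_mkcond; apply: eq_bigr => xy _; rewrite inE; case: (Q xy).
  have swap : \sum_(x : G) \sum_(y : G) (adj x y)%:R * f x =
      \sum_(x : G) \sum_(y : G) (adj x y)%:R * f y.
    by rewrite exchange_big/=; apply: eq_bigr => x _; apply: eq_bigr => y _;
      rewrite adj_sym.
  (* The linear terms cancel by symmetry; with them each summand is [(1 + f x) * (1 - f y) / 4] on
     an arc, which is the indicator [Q (x, y)]. *)
  transitivity ((\sum_(x : G) \sum_(y : G) (adj x y)%:R +
      \sum_(x : G) \sum_(y : G) (adj x y)%:R * f x -
      \sum_(x : G) \sum_(y : G) (adj x y)%:R * f y -
      \sum_(x : G) \sum_(y : G) (adj x y)%:R * (f x * f y)) / 4).
    by rewrite swap addrK.
  rewrite -big_split -!sumrB mulr_suml; apply: eq_bigr => x _.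
  rewrite -big_split -!sumrB mulr_suml; apply: eq_bigr => y _.
  by rewrite /Q /= fE; case: (x \in C); case: (y \in C); case: (adj x y);
    rewrite /=; field.
by rewrite ler_nat.
Qed.

(** Applied to the signs of a maximum cut, the hypothesis bounds it by [(1 + 2 * s) * arcs / 4],
    hence by [(1/2 + s)] times the number of edges. *)
Lemma surplus_le (s : R) : 0 <= s ->
  (forall f : G -> R, (forall x, `|f x| <= 1) ->
    - (2 * s * arcs) <= \sum_(x : G) \sum_(y : G) (adj x y)%:R * (f x * f y)) ->
  surplus R G <= s * #|edges G|%:R.
Proof.
move=> s0 H; rewrite /surplus.
have [|C CE] := bigop.eq_bigmax (fun C : {set G} => #|cut_edges C|).
  by apply/card_gt0P; exists finset.set0.
have -> : maxcut G = #|cut_edges C| by exact: CE.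
pose f (x : G) : R := if x \in C then 1 else -1.
have f1 x : `|f x| <= 1 by rewrite /f; case: ifP; rewrite ?normrN normr1.
have := H f f1; have := @cut_le_form C f erefl; have := arcs_le_edges.
move=> h1 h2 h3.
have := ler_wpM2l s0 h1; lra.
Qed.

End Surplus.

(** * Pinning the vector chromatic number with a complete graph *)

Lemma dotp_row_mx (R : realType) (m n : nat) (a c : 'rV[R]_m) (b d : 'rV[R]_n) :
  dotp (row_mx a b) (row_mx c d) = dotp a c + dotp b d.
Proof.
rewrite /dotp big_split_ord/=; congr (_ + _); apply: eq_bigr => i _.
  by rewrite !row_mxEl.
by rewrite !row_mxEr.
Qed.

Lemma dotp0r (R : realType) (m : nat) (a : 'rV[R]_m) : dotp a 0 = 0.
Proof. by rewrite /dotp big1// => i _; rewrite mxE mulr0. Qed.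

Lemma dotp0l (R : realType) (m : nat) (a : 'rV[R]_m) : dotp 0 a = 0.
Proof. by rewrite /dotp big1// => i _; rewrite mxE mul0r. Qed.

(** The vertices of a regular simplex: the standard basis, centred and rescaled to unit length. *)
Definition simplex (R : realType) (n : nat) (i : 'I_n.+2) : 'rV[R]_n.+2 :=
  \row_b (Num.sqrt (n.+2%:R / n.+1%:R) * ((b == i)%:R - n.+2%:R^-1)).

Lemma dotp_simplex (R : realType) (n : nat) (i j : 'I_n.+2) :
  dotp (simplex R i) (simplex R j) = if i == j then 1 else - n.+1%:R^-1.
Proof.
pose T : R := n.+2%:R; pose c := Num.sqrt (n.+2%:R / n.+1%:R : R).
have c2 : c ^+ 2 = n.+2%:R / n.+1%:R by rewrite sqr_sqrtr// divr_ge0.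
have delta (l : 'I_n.+2) : \sum_(b < n.+2) (b == l)%:R = 1 :> R.
  rewrite (bigD1 l)//= eqxx big1 ?addr0// => b /negPf ->//.
have -> : dotp (simplex R i) (simplex R j) =
    c ^+ 2 * (\sum_(b < n.+2) (b == i)%:R * (b == j)%:R
      - T^-1 * \sum_(b < n.+2) (b == i)%:R
      - T^-1 * \sum_(b < n.+2) (b == j)%:R
      + \sum_(b < n.+2) T^-1 * T^-1).
  rewrite !mulr_sumr -!sumrB -big_split/= mulr_sumr; apply: eq_bigr => b _.
  by rewrite !mxE -/T -/c; ring.
rewrite !delta sum_const card_ord c2.
have -> : \sum_(b < n.+2) (b == i)%:R * (b == j)%:R = (i == j)%:R :> R.
  rewrite (bigD1 i)//= eqxx mul1r big1 ?addr0// => b /negPf ->.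
  by rewrite mul0r.
have n1 : n.+1%:R != 0 :> R by rewrite pnatr_eq0.
have n2 : n.+2%:R != 0 :> R by rewrite pnatr_eq0.
rewrite /T; have E : n.+2%:R = n.+1%:R + 1 :> R by rewrite -natr1.
move: n1 n2; rewrite E; move: (n.+1%:R : R) => a n1 n2.
by case: (i == j) => /=; field; rewrite n1 n2.
Qed.

(* Adding a disjoint complete graph costs a bounded number of edges and pins the vector
   chromatic number to an integer, so that its minimum is attained explicitly. *)
Section UnionComplete.
Variables (R : realType) (G : sgraph) (n : nat).

Definition union_adj : rel (G + 'I_n.+2) := fun x y =>
  match x, y with
  | inl a, inl b => adj a b
  | inr i, inr j => i != j
  | _, _ => false
  end.

Lemma union_adj_sym : symmetric union_adj.
Proof. by move=> [a|i] [b|j] //=; [exact: adj_sym | rewrite eq_sym]. Qed.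

Lemma union_adj_irrefl : irreflexive union_adj.
Proof. by move=> [a|i] /=; [exact: adj_irrefl | rewrite eqxx]. Qed.

Definition union_complete := SGraph union_adj_sym union_adj_irrefl.

Lemma union_form (f : union_complete -> R) :
  \sum_(x : union_complete) \sum_(y : union_complete) (adj x y)%:R * (f x * f y) =
  \sum_(a : G) \sum_(b : G) (adj a b)%:R * (f (inl a) * f (inl b)) +
  \sum_(i < n.+2) \sum_(j < n.+2) (i != j)%:R * (f (inr i) * f (inr j)).
Proof.
rewrite big_sumType/=; congr (_ + _); apply: eq_bigr => x _; rewrite big_sumType/=.
  by rewrite [X in _ + X]big1 ?addr0// => j _; rewrite mul0r.
by rewrite [X in X + _]big1 ?add0r// => j _; rewrite mul0r.
Qed.

Lemma union_arcs : arcs R union_complete =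
  arcs R G + \sum_(i < n.+2) \sum_(j < n.+2) (i != j)%:R.
Proof.
transitivity (\sum_(x : union_complete) \sum_(y : union_complete)
    (adj x y)%:R * (1 * 1) : R).
  by apply: eq_bigr => x _; apply: eq_bigr => y _; rewrite !mulr1.
rewrite (union_form (fun=> 1)); congr (_ + _);
  by apply: eq_bigr => x _; apply: eq_bigr => y _; rewrite !mulr1.
Qed.

(** The value is attained by putting [vec] and the simplex in orthogonal coordinates. It is minimal
    because the sum of the clique's vectors has nonnegative square norm, at most
    [n.+2 * (1 - n.+1 / (kap - 1))]. *)
Lemma union_vector_chromatic_number (D : nat) (vec : G -> 'rV[R]_D) :
  (forall x, dotp (vec x) (vec x) = 1) ->
  (forall x y, adj x y -> dotp (vec x) (vec y) <= - n.+1%:R^-1) ->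
  is_vector_chromatic_number union_complete (n.+2%:R : R).
Proof.
move=> vec1 vecadj; have n1 : 0 < n.+1%:R :> R by rewrite ltr0n.
have nE : n.+2%:R - 1 = n.+1%:R :> R by rewrite -natr1 addrK.
split; first by rewrite ler_nat.
  exists (D + n.+2)%N, (fun x : union_complete => match x with
    | inl a => row_mx (vec a) 0 | inr i => row_mx 0 (simplex R i) end).
  split=> [[a|i]|[a|i] [b|j]] //=; rewrite dotp_row_mx ?dotp0l ?dotp0r ?addr0 ?add0r.
  - exact: vec1.
  - by rewrite dotp_simplex eqxx.
  - by rewrite nE => /vecadj.
  - by rewrite nE dotp_simplex => /negPf ->.
move=> kap kap2 [d [x [x1 xadj]]].
pose X k := \sum_(i < n.+2) x (inr i) ord0 k.
have : 0 <= \sum_(i < n.+2) \sum_(j < n.+2) dotp (x (inr i)) (x (inr j)).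
  have -> : \sum_(i < n.+2) \sum_(j < n.+2) dotp (x (inr i)) (x (inr j)) =
      \sum_(k < d) X k ^+ 2.
    transitivity (\sum_(i < n.+2) \sum_(k < d) x (inr i) ord0 k * X k).
      apply: eq_bigr => i _; rewrite /dotp exchange_big/=; apply: eq_bigr => k _.
      by rewrite mulr_sumr.
    by rewrite exchange_big/=; apply: eq_bigr => k _; rewrite expr2 -mulr_suml.
  by apply: sumr_ge0 => k _; exact: sqr_ge0.
have row (i : 'I_n.+2) : \sum_(j < n.+2) dotp (x (inr i)) (x (inr j)) <=
    1 - n.+1%:R / (kap - 1).
  rewrite (bigD1 i)//= x1 lerD2l.
  apply: (@le_trans _ _ (\sum_(j < n.+2 | j != i) - (kap - 1)^-1)).
    by apply: ler_sum => j ji; apply: xadj => /=; rewrite eq_sym.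
  by rewrite sumr_const cardC1 card_ord -[leLHS]mulr_natl mulrN.
move=> /le_trans /(_ (ler_sum _ (fun i _ => row i))).
rewrite sum_const card_ord pmulr_rge0 ?ltr0n// subr_ge0.
have k1 : 0 < kap - 1 by lra.
by rewrite ler_pdivrMr// mul1r -nE; lra.
Qed.

End UnionComplete.

(** * Assembly of the graph and choice of the parameters *)

Lemma exists_surplus_graph (R : realType) (n : nat) (r sl : R) :
  let e : R := n.+1%:R^-1 in
  e < r <= 1 -> 0 < sl -> sl <= 2 * e -> r * (2 / pi) + r ^+ 3 < sl ->
  exists G : sgraph, [/\ (0 < #|edges G|)%N,
    is_vector_chromatic_number G (n.+2%:R : R) &
    surplus R G <= sl / 2 * #|edges G|%:R].
Proof.
move=> e /andP[er r1] sl0 sl2 gap.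
have e0 : 0 < e by rewrite invr_gt0 ltr0n.
have e1 : e <= 1 by apply: ltW; apply: lt_le_trans r1.
pose w := r * (2 / pi) + r ^+ 3.
(* The gap [sl - w] must cover errors of [4 * th] in the forms and a loss of [2 * th * sl <= 4 * th]
   from the missing weight. *)
pose th := Num.min (2^-1) ((sl - w) / 16) / 2.
have th0 : 0 < th.
  by rewrite divr_gt0// lt_min invr_gt0 ltr0n divr_gt0// subr_gt0.
have th4 : 4 * th <= 1.
  have : 2 * th <= 2^-1 by rewrite /th mulrC divfK// ge_min lexx.
  lra.
have thw : 16 * th <= sl - w.
  have : 2 * th <= (sl - w) / 16 by rewrite /th mulrC divfK// ge_min lexx orbT.
  lra.
have er' : 0 < e < r by rewrite e0.
have [V [p [D [vec [[p01 psym] pdiag [vec1 vecp] psum pform]]]]] :=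
  weighted_graph er' r1 th0.
pose K : R := \sum_(i < n.+2) \sum_(j < n.+2) (i != j)%:R.
have K0 : 0 <= K by do 2 (apply: sumr_ge0 => ? _).
(* With [Z >= K / th] the clique changes the form by at most [K <= Z * th]. *)
have [G [pr [Z [Z0 ZK adjp Gsum Gform]]]] := blowup (K / th) p01 psym pdiag th0.
have KZ : K <= Z * th by rewrite -ler_pdivrMr.
have Gs : Z * (1 - 2 * th) <= arcs R G.
  move: Gsum; rewrite -/(arcs R G) ler_norml => /andP[h _].
  have := ler_wpM2l (ltW Z0) psum; lra.
exists (union_complete G n).
have arcsU : Z * (1 - 2 * th) <= arcs R (union_complete G n).
  by rewrite union_arcs -/K; lra.
split.
- rewrite -(ltr0n R); have := arcs_le_edges R (union_complete G n).
  have : 0 < Z * (1 - 2 * th) by rewrite mulr_gt0//; lra.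
  lra.
- apply: (@union_vector_chromatic_number R G n D (fun x => vec (pr x))) => //.
  by move=> x y /adjp /vecp.
- apply: surplus_le => [|f f1]; first by rewrite divr_ge0// ltW.
  rewrite union_form.
  have [g g1 gf] := Gform (fun a => f (inl a)) (fun a => f1 (inl a)).
  have h1 : - (Z * (w + 3 * th)) <=
      \sum_(a : G) \sum_(b : G) (adj a b)%:R * (f (inl a) * f (inl b)).
    move: gf; rewrite ler_norml => /andP[h _].
    have := ler_wpM2l (ltW Z0) (pform g g1); rewrite -/w; lra.
  have h2 : - K <= \sum_(i < n.+2) \sum_(j < n.+2) (i != j)%:R * (f (inr i) * f (inr j)).
    rewrite -sumrN; apply: ler_sum => i _; rewrite -sumrN; apply: ler_sum => j _.
    rewrite -[X in - X]mulr1 -mulrN ler_wpM2l//.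
    have : `|f (inr i) * f (inr j)| <= 1 by rewrite normrM mulr_ile1.
    by rewrite ler_norml => /andP[].
  have h3 : sl * (Z * (1 - 2 * th)) <= sl * arcs R (union_complete G n).
    by rewrite ler_wpM2l// ltW.
  have h4 : Z * (w + 4 * th) <= sl * (Z * (1 - 2 * th)).
    rewrite [leRHS]mulrCA ler_pM2l//.
    have : sl * th <= 2 * th by rewrite ler_wpM2r ?ltW//; lra.
    lra.
  have -> : 2 * (sl / 2) = sl by field.
  lra.
Qed.

(** With [e = 1 / n.+1] and [chi_vec = n.+2], the bound sought is [sl / 2] times the number of
    edges. The gain [gam] from replacing [pi] by [pi - delta] pays for [r / e > 1] and for the cubic
    term. Asking for an edge excludes the edgeless graphs, where both sides vanish. *)
Theorem theorem2 (R : realType) (delta : R) (hdelta : 0 < delta < 1) :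
  exists (G : sgraph) (chi_vec : R),
    [/\ (0 < #|edges G|)%N,
        is_vector_chromatic_number G chi_vec &
        surplus R G <= #|edges G|%:R / ((pi - delta) * (chi_vec - 1))].
Proof.
case/andP: hdelta => d0 d1.
have p2 := pi_ge2 R.
have pd : 1 < pi - delta :> R by lra.
pose gam : R := 2 / (pi - delta) - 2 / pi.
have gam0 : 0 < gam.
  by rewrite subr_gt0 ltr_pM2l// ltf_pV2 ?posrE; lra.
pose sig : R := Num.min 1 (gam / 4).
have sig0 : 0 < sig by rewrite lt_min ltr01 divr_gt0.
have sig1 : sig <= 1 by rewrite ge_min lexx.
have sigg : sig <= gam / 4 by rewrite ge_min lexx orbT.
(* The bound 2 gives [2 * e <= 1], hence [r <= 1]; the bound [64 / gam] makes
   [r ^+ 3 <= (2 * e) ^+ 3] at most [e * gam / 8]. *)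
have [m m0 mle] := exists_nat_ge (Num.max 2 (64 / gam)).
case: m m0 mle => // n _; rewrite ge_max => /andP[n2 ng].
pose e : R := n.+1%:R^-1.
have n0 : 0 < n.+1%:R :> R by rewrite ltr0n.
have e0 : 0 < e by rewrite invr_gt0.
have e2 : 2 * e <= 1 by rewrite ler_pdivrMr// mul1r.
have eg : 64 * e <= gam by rewrite ler_pdivrMr// mulrC -ler_pdivrMr.
pose r := e * (1 + sig).
pose sl := 2 / (pi - delta) * e.
have slE : sl = (2 / pi + gam) * e by rewrite /sl /gam; ring.
have ip : 2 / pi <= 1 :> R by rewrite ler_pdivrMr; lra.
have ipd : 2 / (pi - delta) <= 2 :> R by rewrite ler_pdivrMr; lra.
have ip0 : 0 < 2 / pi :> R by rewrite divr_gt0//; lra.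
have er : e < r <= 1.
  apply/andP; split; first by rewrite /r ltr_pMr// ltrDl.
  rewrite /r; apply: (le_trans _ e2); rewrite mulrC ler_pM2r//; lra.
have gap : r * (2 / pi) + r ^+ 3 < sl.
  have r2e : r <= 2 * e by rewrite /r mulrC ler_pM2r//; lra.
  have r3 : r ^+ 3 <= e * (gam / 8).
    apply: (@le_trans _ _ ((2 * e) ^+ 3)).
      by rewrite ler_pXn2r ?nnegrE//; lra.
    have -> : (2 * e) ^+ 3 = e * (8 * e * e) by ring.
    rewrite ler_pM2l//; have : 64 * e * e <= gam * e by rewrite ler_pM2r.
    have : gam * e <= gam by rewrite ler_piMr//; lra.
    lra.
  have r1' : r * (2 / pi) <= e * (2 / pi + gam / 4).
    rewrite /r -mulrA ler_pM2l// mulrDl mul1r lerD2l.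
    by apply: (le_trans _ sigg); rewrite ler_piMr// ltW.
  have : 0 < e * gam by rewrite mulr_gt0.
  rewrite slE; lra.
have sl0 : 0 < sl by rewrite mulr_gt0// divr_gt0//; lra.
have sl2 : sl <= 2 * e by rewrite ler_pM2r.
have [G [G0 Gchi Gs]] := @exists_surplus_graph R n r sl er sl0 sl2 gap.
exists G, n.+2%:R; split=> //.
have -> : #|edges G|%:R / ((pi - delta) * (n.+2%:R - 1)) = sl / 2 * #|edges G|%:R.
  have n0' : n.+1%:R != 0 :> R by rewrite gt_eqF.
  have pd0 : pi - delta != 0 by rewrite gt_eqF//; lra.
  rewrite -natr1 addrK /sl /e.
  move: n0' pd0; move: (n.+1%:R : R) (pi - delta) => a b a0 b0.
  by field; rewrite a0 b0.
exact: Gs.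
Qed.
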